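(* There exists a compact HNUP set $W\subset\mathbb{R}$ such that $\dim_H W=1$, $H^1(W)=0$ and $\operatorname{Cap}W>0$. Hence, for any $0<s<1$ and any $0<c<\infty$, there exists a compact HNUP subset $K$ of $W$ such that $\dim_H K=s$ and $H^s(K)=c$. Moreover, the set $W$ can be arranged so that it also satisfies the following additional property: for each $x\in W$ and each $M>1$ there exist two positive numbers $r,R$ with $R/r\ge M$ such that $\{y\in\mathbb{R}: r<|y-x|<R\}\subset\mathbb{R}\setminus W$ and $\{y\in\mathbb{R}: |y-x|\ge R\}\cap W\neq\emptyset$.
   Context: $\mathbb{R}$ is regarded as a subset of $\mathbb{C}$. $H^s$ is $s$-dimensional Hausdorff measure, $H^s(E)=\lim_{\epsilon\to0^+}\inf\{\sum_k d(B_k)^s\}$, the infimum being over countable covers of $E$ by sets $B_k$ with Euclidean diameters $d(B_k)<\epsilon$; $\dim_H$ is Hausdorff dimension. Logarithmic capacity: for a compact set $E\subset\mathbb{C}$ and $n\ge 2$, let $P_n=\max\prod_{1\le j<k\le n}|z_j-z_k|$ over $z_1,\dots,z_n\in E$, and $D_n=P_n^{2/(n(n-1))}$. The sequence $D_n$ is non-increasing, and $\operatorname{Cap}E=\lim_{n\to\infty}D_n$. Uniformly perfect: for $w\in\mathbb{C}$ and $0<r<R<\infty$ let $\mathrm{Ann}(w;r,R)=\{z\in\mathbb{C}: r<|z-w|<R\}$, with modulus $\log(R/r)$. The annulus $A$ separates a set $F\subset\mathbb{C}$ if $F\cap A=\emptyset$ and $F$ intersects both components of $\mathbb{C}\setminus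 A$. A compact set $F\subset\mathbb{C}$ with two or more points is uniformly perfect if there is a uniform finite upper bound on the moduli of all annuli which separate $F$. HNUP (hereditarily non uniformly perfect): a compact set $E$ is HNUP if no (compact) subset of $E$ is uniformly perfect. *)

(* Defs.v *)
From HB Require Import structures.
From mathcomp Require Import all_boot all_order all_algebra.
From mathcomp Require Import all_classical all_reals all_analysis.
From mathcomp Require Import complex.

Set Implicit Arguments.
Unset Strict Implicit.
Unset Printing Implicit Defensive.

Import Order.TTheory GRing.Theory Num.Theory.
Import numFieldNormedType.Exports.

Local Open Scope classical_set_scope.
Local Open Scope ring_scope.
Local Open Scope complex_scope.

(* The regular-algebra tag ^o is what carries the norm topology on the
   concrete field R[i]; this is the Euclidean topology of the plane. *)
Notation cplane R := (R[i]^o).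

Section Definitions.
Variable R : realType.
Local Notation C := (cplane R).
Implicit Types (E F B : set C) (w z : C).

(* The norm `|z| lives in R[i]; Normc.normc is its real value. *)
Definition cdist (z w : C) : R := Normc.normc (z - w).

Definition real_line : set C := range (fun t : R => t%:C : C).

(* The supremum of the empty set in \bar R is -oo; taking the maximum with 0
   gives the empty set diameter 0. *)
Definition diam (B : set C) : \bar R :=
  maxe 0%E (ereal_sup [set (cdist p.1 p.2)%:E | p in B `*` B]).

Definition hausdorff_cover (E : set C) (eps : R) : set (nat -> set C) :=
  [set B | E `<=` \bigcup_k B k /\ forall k, (diam (B k) < eps%:E)%E].

Definition hausdorff_content (s : R) (E : set C) (eps : R) : \bar R :=
  ereal_inf [set (\sum_(k <oo) (diam (B k) `^ s))%E
            | B in hausdorff_cover E eps].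

(* Intended for s > 0, where the empty sets padding a finite cover to a
   sequence contribute 0. *)
Definition hausdorff_measure (s : R) (E : set C) : \bar R :=
  lim (hausdorff_content s E eps @[eps --> 0^'+]).

Definition hausdorff_dim (E : set C) : \bar R :=
  ereal_inf [set s%:E | s in [set s : R | 0 < s /\ hausdorff_measure s E = 0%E]].

(* For compact nonempty E and n >= 2 the supremum is a maximum. *)
Definition max_dist_prod (E : set C) (n : nat) : R :=
  sup [set \prod_(j < n) \prod_(k < n | (j < k)%N) cdist (z j) (z k)
      | z in [set z : 'I_n -> C | forall j, E (z j)]].

Definition nth_diam (E : set C) (n : nat) : R :=
  max_dist_prod E n `^ (2 / (n * n.-1)%:R).

(* The values at n = 0, 1 are junk and do not affect the limit. *)
Definition capacity (E : set C) : R := lim (nth_diam E n @[n --> \oo]).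

Definition annulus (w : C) (r rho : R) : set C :=
  [set z | r < cdist z w < rho].

(* "F meets both components of the complement of A" is rendered as: F meets
   the connected component of every point of the complement. *)
Definition separates (A F : set C) : Prop :=
  F `&` A = set0 /\
  forall z, (~` A) z -> F `&` connected_component (~` A) z !=set0.

Definition uniformly_perfect (F : set C) : Prop :=
  [/\ compact F,
      exists x y, [/\ F x, F y & x <> y]
    & exists b : R, forall w (r rho : R), 0 < r -> r < rho ->
        separates (annulus w r rho) F -> ln (rho / r) <= b].

Definition HNUP (E : set C) : Prop :=
  compact E /\ forall F, F `<=` E -> ~ uniformly_perfect F.

End Definitions.

(* Main.v *)
(** For a strictly increasing sequence [e] of digit positions consider the set
    of all [sum_k u_k 2^-(e_k + 1)] with [u] a sequence of bits.  Inserting zero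
    digits is an order-preserving expansion, so the comparison of this sum with
    the plain binary expansion of [u] (the case [e = id]) is Hoelder continuous
    with exponent [s] as soon as [s e_j + c <= j] for large [j]; pulling back
    Lebesgue measure bounds [H^s] from below, while the [2^j] cylinders of
    diameter [2^-(e_j)] bound it from above along the [j] with
    [j <= s e_j + c'].  Unbounded gaps of [e] produce around each point empty
    annuli of arbitrarily large modulus and arbitrarily small radii, hence no
    uniformly perfect subset, and make [H^1] vanish.

    [W] uses [e_i = i + (log2 i)^2], whose gaps are unbounded although
    [e_i = i + o(i)].  A subset of finite [H^s] measure is obtained by thinning
    [e] to a subsequence with [s e_j + c <= j] for large [j] and
    [j <= s e_j + c + 1] infinitely often; its measure is large with [c], and
    truncating it by its binary parameter gives every smaller value by the
    intermediate value theorem.  For the capacity, the points with binary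
    parameters [i / n] have mutual distances at least [((i - j) / n)^2 / A]. *)
Require Import Defs.
From mathcomp Require Import all_boot all_order all_algebra.
From mathcomp Require Import all_classical all_reals all_analysis.
From mathcomp Require Import complex.
From mathcomp Require Import ring lra zify.

Import Order.TTheory GRing.Theory Num.Theory.
Import numFieldNormedType.Exports.

Local Open Scope classical_set_scope.
Local Open Scope ring_scope.

Set Implicit Arguments.
Unset Strict Implicit.
Unset Printing Implicit Defensive.

(** * Binary sums with prescribed digit positions *)

Section Digits.
Variable R : realType.
Implicit Types (e : nat -> nat) (u v : nat -> bool).

Definition psum e u n : R := \sum_(k < n) (u k)%:R / 2 ^+ (e k).+1.

(** Partial sums are nondecreasing, so this supremum is the value of the series. *)
Definition dsum e u : R := sup (range (psum e u)).

Lemma psumS e u n :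
  psum e u n.+1 = psum e u n + (u n)%:R / 2 ^+ (e n).+1.
Proof. by rewrite /psum big_ord_recr. Qed.

Lemma bool_le1 (b : bool) : 0 <= (b%:R : R) <= 1.
Proof. by case: b; rewrite ?lexx ler01. Qed.

Lemma ler_exp2V m n : (m <= n)%N -> (2 : R) ^- n <= 2 ^- m.
Proof.
move=> mn; rewrite lef_pV2 ?posrE ?exprn_gt0//.
by rewrite ler_eXn2l// ltr1n.
Qed.

Lemma exp2VS n : (2 : R) ^- n = 2 * 2 ^- n.+1.
Proof. by rewrite exprS invfM mulrA divff ?mul1r// pnatr_eq0. Qed.

Lemma exp2V_gt0 n : 0 < (2 : R) ^- n.
Proof. by rewrite invr_gt0 exprn_gt0. Qed.

Lemma psum_nondecreasing e u n m : psum e u n <= psum e u (n + m).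
Proof.
elim: m => [|m IH]; first by rewrite addn0.
by rewrite addnS psumS (le_trans IH)// lerDl mulr_ge0// ltW// exp2V_gt0.
Qed.

(** The next digit adds at most one half of [2^-(e n)], and [2^-(e (n+1))] is at most the other
    half, so the upper estimate never increases with the length. *)
Lemma psum_tail e u n m : (forall i, e i < e i.+1)%N ->
  psum e u (n + m) + 2 ^- e (n + m)%N <= psum e u n + 2 ^- e n.
Proof.
move=> he; elim: m => [|m IH]; first by rewrite addn0.
rewrite addnS (le_trans _ IH)// psumS.
have h1 := ler_exp2V (he (n + m)%N).
have h2 := exp2VS (e (n + m)%N).
have h3 := exp2V_gt0 (e (n + m)%N).+1.
have /andP[h4 h5] := bool_le1 (u (n + m)%N).
have : (u (n + m)%N)%:R / 2 ^+ (e (n + m)%N).+1 <= (2 : R) ^- (e (n + m)%N).+1.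
  by rewrite ler_piMl// ltW.
lra.
Qed.

Lemma psum_le_tail e u n k : (forall i, e i < e i.+1)%N ->
  psum e u k <= psum e u n + 2 ^- e n.
Proof.
move=> he; have [kn|/ltnW nk] := leqP k n.
  rewrite -(subnKC kn) (le_trans (psum_nondecreasing _ _ _ (n - k)))//.
  by rewrite lerDl ltW// exp2V_gt0.
have := psum_tail u n (k - n) he; rewrite subnKC//.
by have := exp2V_gt0 (e k); lra.
Qed.

Lemma dsum_ge e u n : (forall i, e i < e i.+1)%N ->
  psum e u n <= dsum e u.
Proof.
move=> he; apply: ub_le_sup; last by exists n.
by exists (psum e u 0 + 2 ^- e 0%N) => _ [k _ <-]; exact: psum_le_tail.
Qed.

Lemma dsum_le e u n : (forall i, e i < e i.+1)%N ->
  dsum e u <= psum e u n + 2 ^- e n.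
Proof.
move=> he; apply: ge_sup; first by exists (psum e u 0), 0%N.
by move=> _ [k _ <-]; exact: psum_le_tail.
Qed.

Lemma dsum_ge0 e u : (forall i, e i < e i.+1)%N -> 0 <= dsum e u.
Proof. by move=> he; have := dsum_ge u 0 he; rewrite /psum big_ord0. Qed.

Lemma dsum_le1 e u : (forall i, e i < e i.+1)%N -> dsum e u <= 1.
Proof.
move=> he; have := dsum_le u 0 he; rewrite /psum big_ord0 add0r => /le_trans.
by apply; rewrite invf_le1 ?exprn_gt0// exprn_ege1// ler1n.
Qed.

Lemma id_ltS i : (id i < id i.+1)%N. Proof. by []. Qed.

(** * Comparison of digit prefixes with the plain binary expansion *)

Definition scaled_diff e u v n : R :=
  2 ^+ (e n).+1 * (psum e u n.+1 - psum e v n.+1).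

(* Between the integers coded by two digit prefixes, inserting zero digits
   only increases the distance. *)
Lemma scaled_diff_spread e u v n : (forall i, e i < e i.+1)%N ->
  let p := scaled_diff e u v n in let q := scaled_diff id u v n in
  [\/ p = 0 /\ q = 0, 1 <= q <= p | 1 <= - q <= - p].
Proof.
move=> he /=; elim: n => [|n IH].
  rewrite /scaled_diff !psumS /psum !big_ord0 !add0r -!mulrBl.
  rewrite ![2 ^+ _ * _]mulrC !divfK ?expf_neq0 ?pnatr_eq0//.
  by case: (u 0%N); case: (v 0%N); rewrite ?subrr ?subr0 ?sub0r ?opprK ?lexx;
    [constructor 1|constructor 2|constructor 3|constructor 1].
have rec f : (f n < f n.+1)%N -> scaled_diff f u v n.+1 =
    2 ^+ (f n.+1 - f n) * scaled_diff f u v n + ((u n.+1)%:R - (v n.+1)%:R).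
  move=> hf; rewrite /scaled_diff [psum f u n.+2]psumS [psum f v n.+2]psumS.
  rewrite mulrA -exprD addnS subnK ?(ltnW hf)//.
  have : (2 : R) ^+ (f n.+1).+1 != 0 by rewrite expf_neq0// pnatr_eq0.
  by move: (2 ^+ (f n.+1).+1) => a a0; field.
rewrite !rec//= subSnn expr1.
have : (2 : R) <= 2 ^+ (e n.+1 - e n).
  by rewrite -{1}[2]expr1 ler_weXn2l ?ler1n// subn_gt0.
move: (scaled_diff e u v n) (scaled_diff id u v n) (_ ^+ _) IH => p q g IH hg.
have hd : [\/ (u n.+1)%:R - (v n.+1)%:R = 0 :> R,
    (u n.+1)%:R - (v n.+1)%:R = 1 :> R | (u n.+1)%:R - (v n.+1)%:R = -1 :> R].
  by case: (u n.+1); case: (v n.+1); rewrite ?subrr ?subr0 ?sub0r;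
    [constructor 1|constructor 2|constructor 3|constructor 1].
(* With [d] the digit difference, the recursion reads [q' = 2 q + d] and [p' = g p + d], where
   [g >= 2]; from [1 <= q <= p] follows [1 <= q' <= p'], and symmetrically for the negatives. *)
case: IH => [[-> ->]|/andP[h1 h2]|/andP[h1 h2]].
- rewrite !mulr0 !add0r.
  by case: hd => ->; [constructor 1|constructor 2|constructor 3];
    rewrite ?opprK ?lexx.
- by constructor 2; case: hd => ->; apply/andP; split; nra.
- by constructor 3; case: hd => ->; apply/andP; split; nra.
Qed.

Lemma scaled_diffE e u v n :
  psum e u n.+1 - psum e v n.+1 = scaled_diff e u v n * 2 ^- (e n).+1.
Proof.
by rewrite /scaled_diff mulrAC divff ?mul1r// expf_neq0// pnatr_eq0.
Qed.

Lemma dsum_dist_psum e u v n : (forall i, e i < e i.+1)%N ->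
  `|(dsum e u - dsum e v) - (psum e u n - psum e v n)| <= 2 ^- e n.
Proof.
move=> he; have := dsum_ge u n he; have := dsum_le u n he.
have := dsum_ge v n he; have := dsum_le v n he.
by rewrite ler_norml => *; apply/andP; split; lra.
Qed.

(** In units of [2^-(e n + 1)] the points differ by less than 2 and the tails contribute at most 1,
    so the prefixes differ by less than 3. The binary prefixes differ by no more units, now of size
    [2^-(n+1)], and their tails add one more. *)
Lemma dsum_dist_id e u v n : (forall i, e i < e i.+1)%N ->
  `|dsum e u - dsum e v| < 2 ^- e n ->
  `|dsum id u - dsum id v| <= 2 * 2 ^- n.
Proof.
move=> he hd.
have := dsum_dist_psum u v n.+1 he.
have := dsum_dist_psum u v n.+1 id_ltS.
have := scaled_diffE e u v n; have := scaled_diffE id u v n.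
have hs := scaled_diff_spread u v n he.
have := ler_exp2V (he n); have e1 := exp2VS (e n); have e2 := exp2VS n.
move=> /= l1 -> ->.
move: hd; rewrite ltr_norml !ler_norml.
move: hs => /=.
move: (scaled_diff e u v n) (scaled_diff id u v n) => p q hs.
move=> /andP[h1 h2] /andP[h3 h4] /andP[h5 h6].
have g1 := exp2V_gt0 (e n).+1; have g2 := exp2V_gt0 n.+1.
suff /andP[q1 q2] : - 3 <= q <= 3.
  have : q * 2 ^- n.+1 <= 3 * 2 ^- n.+1 by rewrite ler_pM2r.
  have : - 3 * 2 ^- n.+1 <= q * 2 ^- n.+1 by rewrite ler_pM2r.
  by move=> *; apply/andP; split; lra.
have p1 : p < 3.
  suff : p * 2 ^- (e n).+1 < 3 * 2 ^- (e n).+1 by rewrite ltr_pM2r.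
  by lra.
have p2 : - 3 < p.
  suff : - 3 * 2 ^- (e n).+1 < p * 2 ^- (e n).+1 by rewrite ltr_pM2r.
  by lra.
by case: hs => [[_ ->]|/andP[]|/andP[]]; lra.
Qed.

(** Distinct prefixes are at least one unit [2^-(e n + 1)] apart, and the tails recover at most
    [2^-(e (n+1))]. At a long gap of [e] the two alternatives leave an empty annulus between
    them. *)
Lemma dsum_dist_dichotomy e u v n : (forall i, e i < e i.+1)%N ->
  psum id u n.+1 = psum id v n.+1 /\ `|dsum e u - dsum e v| <= 2 ^- e n.+1
  \/ 2 ^- (e n).+1 - 2 ^- e n.+1 <= `|dsum e u - dsum e v|.
Proof.
move=> he; have := dsum_dist_psum u v n.+1 he.
have := scaled_diffE e u v n; have := scaled_diffE id u v n.
have := scaled_diff_spread u v n he => /= hs.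
have g1 := exp2V_gt0 (e n).+1.
move=> eq1 -> hd.
case: hs => [[p0 q0]|/andP[q1 qp]|/andP[q1 qp]].
- left; move: eq1 hd; rewrite p0 q0 !mul0r subr0 => /eqP.
  by rewrite subr_eq0 => /eqP.
- right; move: hd; rewrite ler_norml => /andP[h1 h2].
  by rewrite (le_trans _ (ler_norm _))//; nra.
- right; move: hd; rewrite ler_norml => /andP[h1 h2].
  by rewrite distrC (le_trans _ (ler_norm _))//; nra.
Qed.

(** Prefixes are compared by their binary value, which is what [prefix_code] provides; equal values
    force a zero scaled difference for [e] too, leaving only the tails. *)
Lemma psum_dist_cyl e u v n : (forall i, e i < e i.+1)%N ->
  psum id u n = psum id v n -> `|dsum e u - dsum e v| <= 2 ^- e n.
Proof.
move=> he; case: n => [|n] h.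
  have := dsum_dist_psum u v 0 he.
  by rewrite /psum !big_ord0 subrr subr0.
have := dsum_dist_psum u v n.+1 he.
have := scaled_diffE e u v n; have := scaled_diffE id u v n.
have := scaled_diff_spread u v n he => /= hs.
rewrite h subrr => /esym/eqP.
rewrite mulf_eq0 (gt_eqF (exp2V_gt0 _)) orbF => /eqP q0 ->.
by case: hs; rewrite q0; [case=> -> _; rewrite mul0r subr0| |]; lra.
Qed.

Lemma psum_agree e u v n : (forall k, (k < n)%N -> u k = v k) ->
  psum e u n = psum e v n.
Proof. by move=> h; apply: eq_bigr => k _; rewrite h. Qed.

Lemma dsum_agree e u v n : (forall i, e i < e i.+1)%N ->
  (forall k, (k < n)%N -> u k = v k) -> `|dsum e u - dsum e v| <= 2 ^- e n.
Proof. by move=> he h; apply: psum_dist_cyl => //; exact: psum_agree. Qed.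

(** * Integer codes of prefixes and surjectivity of the binary sum *)

Fixpoint prefix_code u n : nat :=
  if n is m.+1 then ((prefix_code u m).*2 + u m)%N else 0%N.

Lemma prefix_codeE u n : (prefix_code u n)%:R = 2 ^+ n * psum id u n.
Proof.
elim: n => [|n IH]; first by rewrite /psum big_ord0 mulr0.
rewrite /= natrD -mul2n natrM IH psumS mulrDr exprS mulrA; congr (_ + _).
by rewrite mulrCA -exprS divff ?mulr1// expf_neq0// pnatr_eq0.
Qed.

Lemma dsum_id_onto (y : R) : 0 <= y < 1 -> exists u, dsum id u = y.
Proof.
move=> /andP[y0 y1]; pose u n := odd (Num.truncn (2 ^+ n.+1 * y)).
exists u.
(* The first [n] digits code the floor of [2^n y]; the base case is where [y < 1] enters. *)
have code n : prefix_code u n = Num.truncn (2 ^+ n * y).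
  elim: n => [|n IH].
    rewrite /= expr0 mul1r; apply/esym/eqP.
    by rewrite -leqn0 truncn_le_nat.
  rewrite /= IH /u addnC -[RHS]odd_double_half; congr (_ + _.*2)%N.
  have p0 : 0 <= 2 ^+ n * y by rewrite mulr_ge0// exprn_ge0.
  have p1 : 0 <= 2 ^+ n.+1 * y by rewrite mulr_ge0// exprn_ge0.
  have /andP[a1 a2] := truncn_itv p0; have /andP[b1 b2] := truncn_itv p1.
  move: a1 a2 b1 b2; rewrite exprS -mulrA.
  move: (2 ^+ n * y) => z.
  set a := Num.truncn z; set b := Num.truncn _ => a1 a2 b1 b2.
  have c1 : (a.*2 <= b)%N.
    rewrite -ltnS -(ltr_nat R) -mul2n natrM.
    by apply: le_lt_trans b2; rewrite ler_pM2l.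
  have c2 : (b < (a.+1).*2)%N.
    rewrite -(ltr_nat R) -mul2n natrM; apply: le_lt_trans b1 _.
    by rewrite ltr_pM2l.
  by lia.
apply/eqP; rewrite -subr_eq0 -normr_le0; apply/ler_addgt0Pr => eps eps0.
rewrite add0r.
have [n _ hn] := near_infty_natSinv_expn_lt (PosNum eps0).
have {}hn := hn n (leqnn n).
have h0 : (2 : R) ^+ n != 0 by rewrite expf_neq0// pnatr_eq0.
have hp := exp2V_gt0 n.
have p0 : 0 <= 2 ^+ n * y by rewrite mulr_ge0// exprn_ge0.
have /andP[] := truncn_itv p0.
rewrite -code -(natr1 (prefix_code u n)) prefix_codeE.
rewrite ler_pM2l ?exprn_gt0// => a1 a2.
have a3 : y < psum id u n + 2 ^- n.
  have : 2 ^+ n * y < 2 ^+ n * (psum id u n + 2 ^- n).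
    by rewrite mulrDr divff.
  by rewrite ltr_pM2l ?exprn_gt0.
have d1 := dsum_ge u n id_ltS; have d2 := dsum_le u n id_ltS.
move: d2 hn => /= d2; rewrite div1r => hn.
by rewrite ler_norml; apply/andP; split; lra.
Qed.

End Digits.

Arguments psum {R} e u n.
Arguments dsum {R} e u.
Arguments exp2V_gt0 {R} n.
Arguments exp2VS {R} n.
Arguments ler_exp2V {R m n}.
Arguments dsum_ge {R e} u n.
Arguments dsum_le {R e} u n.
Arguments dsum_ge0 {R e} u.
Arguments dsum_le1 {R e} u.
Arguments dsum_dist_id {R e u v n}.
Arguments dsum_dist_dichotomy {R e} u v n.
Arguments psum_dist_cyl {R e u v n}.
Arguments dsum_agree {R e u v n}.
Arguments prefix_codeE {R} u n.

(** * Hausdorff measure and dimension *)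

Section Hausdorff.
Variable R : realType.
Local Notation C := (cplane R).
Implicit Types (E F B : set C) (s t eps : R).

Lemma diam_ge0 B : (0 <= diam B)%E.
Proof. by rewrite /diam le_max lexx. Qed.

Lemma diam_le B (d : R) : 0 <= d ->
  (forall x y, B x -> B y -> cdist x y <= d) -> (diam B <= d%:E)%E.
Proof.
move=> d0 h; rewrite /diam ge_max lee_fin d0/=.
by apply: ge_ereal_sup => _ [[x y] [Bx By] <-]; rewrite lee_fin; exact: h.
Qed.

Lemma cdist_le_diam B x y : B x -> B y -> ((cdist x y)%:E <= diam B)%E.
Proof.
move=> Bx By; rewrite /diam le_max; apply/orP; right.
by apply: ereal_sup_ubound; exists (x, y).
Qed.

Lemma diam_set0 : diam (set0 : set C) = 0%E.
Proof. by apply/eqP; rewrite eq_le diam_ge0 andbT; exact: diam_le. Qed.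

Lemma diam_fin B eps : (diam B < eps%:E)%E ->
  exists2 d : R, diam B = d%:E & 0 <= d < eps.
Proof.
move=> h; exists (fine (diam B)); first by
  rewrite fineK// ge0_fin_numE ?diam_ge0// (lt_trans h)// ltry.
rewrite fine_ge0 ?diam_ge0//= -lte_fin fineK//.
by rewrite ge0_fin_numE ?diam_ge0// (lt_trans h)// ltry.
Qed.

Lemma hausdorff_content_ge0 s E eps : (0 <= hausdorff_content s E eps)%E.
Proof.
apply: le_ereal_inf_tmp => _ [B _ <-].
by apply: nneseries_ge0 => *; exact: poweR_ge0.
Qed.

Lemma hausdorff_content_subset s E F eps : E `<=` F ->
  (hausdorff_content s E eps <= hausdorff_content s F eps)%E.
Proof.
move=> EF; apply: ereal_inf_le_tmp => _ [B [FB Be] <-].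
by exists B => //; split => //; exact: subset_trans FB.
Qed.

Lemma hausdorff_content_nonincreasing s E eps1 eps2 : eps1 <= eps2 ->
  (hausdorff_content s E eps2 <= hausdorff_content s E eps1)%E.
Proof.
move=> le12; apply: ereal_inf_le_tmp => _ [B [FB Be] <-].
by exists B => //; split => // k; rewrite (lt_le_trans (Be k))// lee_fin.
Qed.

(** The content grows as [eps] decreases, so the right limit at 0 exists and is the supremum. *)
Lemma hausdorff_measureE s E : hausdorff_measure s E =
  ereal_sup [set hausdorff_content s E eps | eps in `]0, +oo[].
Proof.
apply: cvg_lim => //.
apply: (nonincreasing_at_right_cvge +oo%O) => // x y _ _.
exact: hausdorff_content_nonincreasing.
Qed.

Lemma hausdorff_content_le s E eps : 0 < eps ->
  (hausdorff_content s E eps <= hausdorff_measure s E)%E.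
Proof.
move=> e0; rewrite hausdorff_measureE; apply: ereal_sup_ubound.
by exists eps => //=; rewrite in_itv/= e0.
Qed.

Lemma hausdorff_measure_le s E x :
  (forall eps, 0 < eps -> (hausdorff_content s E eps <= x)%E) ->
  (hausdorff_measure s E <= x)%E.
Proof.
move=> h; rewrite hausdorff_measureE; apply: ge_ereal_sup => y [eps].
by rewrite /= in_itv/= andbT => e0 <-; exact: h.
Qed.

Lemma hausdorff_measure_ge0 s E : (0 <= hausdorff_measure s E)%E.
Proof.
by rewrite (le_trans (hausdorff_content_ge0 s E 1))// hausdorff_content_le.
Qed.

Lemma hausdorff_measure_subset s E F : E `<=` F ->
  (hausdorff_measure s E <= hausdorff_measure s F)%E.
Proof.
move=> EF; apply: hausdorff_measure_le => eps e0.
exact: le_trans (hausdorff_content_subset _ _ EF) (hausdorff_content_le _ _ e0).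
Qed.

Lemma hausdorff_measure_set0 s : 0 < s -> hausdorff_measure s set0 = 0%E.
Proof.
move=> s0; apply/eqP; rewrite eq_le hausdorff_measure_ge0 andbT.
apply: hausdorff_measure_le => eps e0; apply: ereal_inf_lbound.
exists (fun=> set0); first by split => // k; rewrite diam_set0 lte_fin.
by apply: eseries0 => k _ _; rewrite diam_set0 poweR0r// gt_eqF.
Qed.

(** Prepends [N] sets of diameter at most [d] to a cover of [E]; this is the form of subadditivity
    used for arcs. *)
Lemma hausdorff_content_finite_cover s E F eps (d : R) N (D : nat -> set C) :
  0 <= s -> 0 <= d < eps -> F `<=` \bigcup_(i < N) D i ->
  (forall i, (diam (D i) <= d%:E)%E) ->
  (hausdorff_content s (E `|` F) eps <=
   hausdorff_content s E eps + (N%:R * d `^ s)%:E)%E.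
Proof.
move=> s0 /andP[d0 de] FD Dd; rewrite -leeBlDr//.
apply: le_ereal_inf_tmp => _ [B [EB Be] <-]; rewrite leeBlDr//.
pose B' k := if (k < N)%N then D k else B (k - N)%N.
apply: (@le_trans _ _ (\sum_(k <oo) (diam (B' k) `^ s))%E).
  apply: ereal_inf_lbound; exists B' => //.
  split => [x [/EB[k _ Bk]|/FD[k kN Dk]]|k].
  - by exists (k + N)%N => //; rewrite /B' ltnNge leq_addl/= addnK.
  - by exists k => //; rewrite /B' kN.
  - by rewrite /B'; case: ifP => // _; rewrite (le_lt_trans (Dd k))// lte_fin.
rewrite (nneseries_split 0 N); last by move=> *; exact: poweR_ge0.
rewrite add0n addeC; apply: leeD.
  rewrite -nneseries_addn; last by move=> *; exact: poweR_ge0.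
  apply: lee_nneseries => [*|k _]; first exact: poweR_ge0.
  by rewrite /B' ltnNge leq_addl/= addnK.
apply: (@le_trans _ _ (\sum_(0 <= k < N) (d `^ s)%:E)%E); last first.
  by rewrite sumEFin big_const_nat subn0 iter_addr_0 mulr_natl.
rewrite !big_nat; apply: lee_sum => k /andP[_ kN]; rewrite /B' kN -poweR_EFin.
by apply: gt0_ler_poweR => //; rewrite in_itv/= ?leey ?diam_ge0 ?lee_fin ?d0.
Qed.

(** For diameters below [eps'], [d^t = d^(t-s) d^s <= eps'^(t-s) d^s], and the factor tends to 0
    with [eps']. *)
Lemma hausdorff_measure_lt_pinfty_eq0 s t E : 0 < s -> s < t ->
  (hausdorff_measure s E < +oo)%E -> hausdorff_measure t E = 0%E.
Proof.
move=> s0 st fin; apply/eqP; rewrite eq_le hausdorff_measure_ge0 andbT.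
have mfin : hausdorff_measure s E \is a fin_num.
  by rewrite ge0_fin_numE// hausdorff_measure_ge0.
(* The summand 1 makes [c] positive and strictly larger than the measure. *)
pose c := fine (hausdorff_measure s E) + 1.
have c0 : 0 < c.
  by rewrite ltr_wpDl// fine_ge0// hausdorff_measure_ge0.
have mc : (hausdorff_measure s E < c%:E)%E.
  by rewrite -(fineK mfin) lte_fin ltrDl.
apply: hausdorff_measure_le => eps e0.
apply/lee_addgt0Pr => del del0; rewrite add0e.
have ts0 : 0 < t - s by rewrite subr_gt0.
(* The second term of the minimum gives [eps'^(t-s) <= del / c]. *)
pose eps' := Num.min eps ((del / c) `^ (t - s)^-1).
have e'0 : 0 < eps' by rewrite lt_min e0 powR_gt0// divr_gt0.
have e'e : eps' <= eps by rewrite ge_min lexx.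
apply: le_trans (hausdorff_content_nonincreasing t E e'e) _.
have : (hausdorff_content s E eps' < c%:E)%E.
  exact: le_lt_trans (hausdorff_content_le _ _ e'0) mc.
move=> /ereal_inf_lt[_ [B [EB Be] <-]] Bc.
apply: (@le_trans _ _ (\sum_(k <oo) (diam (B k) `^ t))%E).
  by apply: ereal_inf_lbound; exists B.
apply: (@le_trans _ _
  (\sum_(k <oo) ((eps' `^ (t - s))%:E * diam (B k) `^ s))%E).
  apply: lee_nneseries => [*|k _]; first exact: poweR_ge0.
  have [d -> /andP[d0 de]] := diam_fin (Be k).
  rewrite !poweR_EFin -EFinM lee_fin -[X in d `^ X](subrK s).
  have [->|dn0] := eqVneq d 0.
    by rewrite subrK !powR0 ?mulr0// gt_eqF// (lt_trans s0).
  rewrite (@powRD _ d) ?dn0 ?implybT// ler_wpM2r ?powR_ge0//.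
  by rewrite ge0_ler_powR ?nnegrE// ltW.
rewrite nneseriesZl; last by move=> *; exact: poweR_ge0.
apply: (@le_trans _ _ ((del / c)%:E * c%:E)%E); last first.
  by rewrite -EFinM divfK// gt_eqF.
apply: lee_pmul; rewrite ?lee_fin ?powR_ge0//.
- by apply: nneseries_ge0 => *; exact: poweR_ge0.
- have -> : del / c = ((del / c) `^ (t - s)^-1) `^ (t - s).
    rewrite -powRrM mulVf ?gt_eqF// powRr1// ltW// divr_gt0//.
  rewrite ge0_ler_powR ?nnegrE ?powR_ge0 ?(ltW ts0) ?(ltW e'0)//.
  by rewrite ge_min lexx orbT.
- exact: ltW.
Qed.

(** Finiteness at [s] makes every larger exponent null, while a null smaller exponent would make [s]
    null as well. *)
Lemma hausdorff_dim_eq s (c : R) E : 0 < s -> 0 < c ->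
  hausdorff_measure s E = c%:E -> hausdorff_dim E = s%:E.
Proof.
move=> s0 c0 Ec; apply/eqP; rewrite eq_le; apply/andP; split.
  apply/lee_addgt0Pr => del del0; apply: ereal_inf_lbound.
  exists (s + del) => //; split; first exact: addr_gt0.
  by apply: (hausdorff_measure_lt_pinfty_eq0 s0); rewrite ?ltrDl// Ec ltry.
apply: le_ereal_inf_tmp => _ [t [t0 Et] <-]; rewrite lee_fin leNgt.
apply/negP => ts; have : hausdorff_measure s E = 0%E.
  by apply: (hausdorff_measure_lt_pinfty_eq0 t0 ts); rewrite Et ltry.
by rewrite Ec => -[] c00; rewrite c00 ltxx in c0.
Qed.

End Hausdorff.

(** * Hausdorff measure of digit sets *)

Section DigitSets.
Variable R : realType.
Local Notation C := (cplane R).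
Implicit Types (e : nat -> nat) (u v : nat -> bool).

Definition emb (t : R) : C := (t%:C)%C.

Lemma cdist_emb (a b : R) : cdist (emb a) (emb b) = `|a - b|.
Proof.
by rewrite /cdist /emb /Normc.normc /= subrr expr0n addr0 sqrtr_sqr.
Qed.

Lemma powR_exp2V m (s : R) : (2 ^- m) `^ s = 2 `^ (- (s * m%:R)).
Proof. by rewrite -powR_invn// -powRrM mulNr mulrC. Qed.

Lemma exp2V_lt (x : R) : 0 < x -> exists n, 2 ^- n < x.
Proof.
move=> x0.
have [n _ /(_ n (leqnn n))] := near_infty_natSinv_expn_lt (PosNum x0).
by rewrite /= div1r => h; exists n.
Qed.

Lemma ge_id e : (forall i, e i < e i.+1)%N -> forall i, (i <= e i)%N.
Proof. by move=> he; elim=> // i IH; exact: leq_ltn_trans (he i). Qed.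

Lemma ltS_homo e : (forall i, e i < e i.+1)%N ->
  {homo e : i j / (i < j)%N >-> (i < j)%N}.
Proof. by move=> he; exact: homo_ltn ltn_trans he. Qed.

Lemma ltS_homo_le e : (forall i, e i < e i.+1)%N ->
  {homo e : i j / (i <= j)%N >-> (i <= j)%N}.
Proof.
by move=> he; apply: homo_leq => // [? ? ?|i]; [exact: leq_trans|exact: ltnW].
Qed.

(** Take the least [m] with [2^-(e m) <= d]. Then [d < 2^-(e (m-1))] bounds the binary distance by
    [4 * 2^-m], and [s e_m + c <= m] bounds [2^-m] by [2^(-c) d^s]. Distance 0 admits no such [m]
    and is handled by letting the level grow. *)
Lemma dsum_holder e (s c : R) j0 u v : (forall i, e i < e i.+1)%N -> 0 < s ->
  (forall j, (j0 <= j)%N -> s * (e j)%:R + c <= j%:R) ->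
  `|dsum e u - dsum e v| < 2 ^- e j0 :> R ->
  `|dsum id u - dsum id v| <= 4 * 2 `^ (- c) * `|dsum e u - dsum e v| `^ s.
Proof.
move=> he s0 hj; set d : R := `|dsum e u - dsum e v| => dj0.
have [d0|dn0] := eqVneq d 0.
  rewrite d0 powR0 ?gt_eqF// mulr0; apply/ler_addgt0Pr => x x0; rewrite add0r.
  have [n hn] := exp2V_lt (divr_gt0 x0 (@ltr0n R 2)).
  have := @dsum_dist_id R e u v n he; rewrite -/d d0 exp2V_gt0 => /(_ isT).
  by move=> /le_trans; apply; lra.
have d_gt0 : 0 < d by rewrite lt_neqAle eq_sym dn0 normr_ge0.
have ex : exists i, 2 ^- e i <= d.
  have [n hn] := exp2V_lt d_gt0; exists n.
  by rewrite (le_trans _ (ltW hn))// ler_exp2V// ge_id.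
case: (ex_minnP ex) => m md mmin.
(* This makes [m] a successor and puts it in the range of [hj]. *)
have j0m : (j0 < m)%N.
  rewrite ltnNge; apply/negP => mj0.
  have := lt_le_trans dj0 (le_trans (ler_exp2V (ltS_homo_le he mj0)) md).
  by rewrite ltxx.
case: m j0m md mmin => // i j0i md mmin.
have di : d < 2 ^- e i by rewrite ltNge; apply/negP => /mmin; rewrite ltnn.
apply: le_trans (dsum_dist_id he di) _.
have -> : 2 * 2 ^- i = 4 * 2 ^- i.+1 :> R by rewrite (exp2VS i); ring.
rewrite -mulrA ler_pM2l//.
apply: (@le_trans _ _ (2 `^ (- c) * (2 ^- e i.+1) `^ s)); last first.
  rewrite ler_wpM2l ?powR_ge0// ge0_ler_powR ?nnegrE ?(ltW s0)//.
  exact: ltW.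
rewrite powR_exp2V -powRD ?pnatr_eq0 ?implybT// -powR_invn//.
by apply: ler_powR; [rewrite ler1n|have := hj i.+1 (ltnW j0i); lra].
Qed.

(* Restricting the binary parameter [dsum id u], rather than the point itself,
   makes the [H^s]-measure of an arc Lipschitz in its endpoints. *)
Definition digit_arc e (a b : R) : set C :=
  [set emb (dsum e u) | u in [set u | a <= dsum id u <= b]].

Lemma digit_arc01 e : digit_arc e 0 1 = range (emb \o dsum e).
Proof.
apply/seteqP; split => [_ [u _ <-]|_ [u _ <-]]; first by exists u.
by exists u => //=; rewrite dsum_ge0// dsum_le1.
Qed.

(** By the Hoelder estimate a cover set of diameter [d] pulls back to binary parameters within an
    interval of length [8 * 2^(-c) * d^s]. These intervals cover [[0, 1)], so subadditivity of
    Lebesgue measure bounds the sum from below. *)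
Lemma hausdorff_measure_digit_ge e (s c : R) j0 :
  (forall i, e i < e i.+1)%N -> 0 < s ->
  (forall j, (j0 <= j)%N -> s * (e j)%:R + c <= j%:R) ->
  ((2 `^ c / 8)%:E <= hausdorff_measure s (digit_arc e 0 1))%E.
Proof.
move=> he s0 hj; rewrite digit_arc01.
apply: le_trans (hausdorff_content_le _ _ (exp2V_gt0 (e j0))).
apply: le_ereal_inf_tmp => _ [B [XB Be] <-].
pose d k := fine (diam (B k)).
have dE k : diam (B k) = (d k)%:E.
  by have [x Dx _] := diam_fin (Be k); rewrite /d Dx.
have de k : 0 <= d k < 2 ^- e j0.
  by have [x Dx h] := diam_fin (Be k); rewrite /d Dx.
pose r k := 4 * 2 `^ (- c) * d k `^ s.
pose T k := [set u | B k (emb (dsum e u))].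
(* If [B k] misses the digit set, the default sequence is taken; such an interval only enlarges the
   cover. *)
pose y k : R := dsum id (xget (fun=> false) (T k)).
pose I k := `[y k - r k, y k + r k]%classic.
have r0 k : 0 <= r k by rewrite !mulr_ge0 ?powR_ge0.
have cov : `[0, 1[%classic `<=` \bigcup_k I k.
  move=> x /=; rewrite in_itv/= => /dsum_id_onto[u ux].
  have [k _ Bk] := XB _ (imageT (emb \o dsum e) u); exists k => //.
  have Tu : T k u by [].
  have Tv : T k (xget (fun=> false) (T k)) by apply: xgetPex; exists u.
  rewrite /I /= in_itv/= -ler_distl -ux /y.
  move: Tv; set v := xget _ _ => Tv.
  have duv : `|dsum e u - dsum e v| <= d k.
    by rewrite -lee_fin -dE -cdist_emb; exact: cdist_le_diam.
  apply: le_trans (dsum_holder he s0 hj _) _.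
    by apply: le_lt_trans duv _; case/andP: (de k).
  rewrite ler_wpM2l ?mulr_ge0 ?powR_ge0// ge0_ler_powR ?nnegrE ?(ltW s0)//.
  by case/andP: (de k).
have : (lebesgue_measure (`[0%R, 1%R[ : set R) <=
    \sum_(k <oo) lebesgue_measure (I k))%E.
  by apply: measure_sigma_subadditive => [k||//]; exact: measurable_itv.
rewrite lebesgue_measure_itv/= lte_fin ltr01 sube0.
rewrite (_ : (\sum_(n <oo) _)%E =
   ((8 * 2 `^ (- c))%:E * \sum_(k <oo) diam (B k) `^ s)%E); last first.
  rewrite -nneseriesZl; last by move=> *; exact: poweR_ge0.
  apply: eq_eseriesr => k _.
  rewrite lebesgue_measure_itv/= lte_fin dE poweR_EFin.
  case: ltP => h; rewrite -?EFinD -EFinM; congr (_%:E).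
    by rewrite /r; lra.
  have : r k = 0 by have := r0 k; lra.
  by rewrite /r; lra.
move=> h; have c0 : 0 < 8 * 2 `^ (- c) :> R by rewrite mulr_gt0 ?powR_gt0.
rewrite -(lee_pmul2l (x := (8 * 2 `^ (- c))%:E))// (le_trans _ h)//.
rewrite -EFinM lee_fin.
have : 2 `^ c != 0 :> R by rewrite gt_eqF// powR_gt0.
by rewrite powRN => c1; rewrite le_eqVlt; apply/orP; left; apply/eqP; field.
Qed.

(** Points of the arc have level-[j] prefix codes between [2^j a - 1] and [2^j b]; each code gives
    one set of the cover. *)
Lemma digit_arc_cover e j (a b : R) : (forall i, e i < e i.+1)%N -> a <= b ->
  exists N (D : nat -> set C), [/\ N%:R <= 2 ^+ j * (b - a) + 3,
    digit_arc e a b `<=` \bigcup_(i < N) D i &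
    forall i, (diam (D i) <= (2 ^- e j)%:E)%E].
Proof.
(* A dyadic parameter may be expanded with trailing ones, and its code is then one below the floor;
   hence the predecessor. For negative [a] the truncation gives 0. *)
move=> he ab; pose k0 := (Num.truncn (2 ^+ j * a)).-1.
have ba0 : 0 <= 2 ^+ j * (b - a) by rewrite mulr_ge0 ?exprn_ge0// subr_ge0.
exists (Num.truncn (2 ^+ j * (b - a) + 2)).+1.
exists (fun i =>
  [set emb (dsum e u) | u in [set u | prefix_code u j = (k0 + i)%N]]).
split.
- have /andP[h _] := truncn_itv (addr_ge0 ba0 (ler0n R 2)).
  by rewrite -natr1; lra.
- move=> _ [u /= /andP[ua ub] <-].
  have pu := @prefix_codeE R u j.
  have lo : 2 ^+ j * dsum id u <= (prefix_code u j)%:R + 1 :> R.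
    have h1 : 2 ^+ j / 2 ^+ j = 1 :> R.
      by rewrite divff// expf_neq0// pnatr_eq0.
    rewrite pu -[X in _ + X]h1 -mulrDr.
    by rewrite ler_pM2l ?exprn_gt0//; exact: dsum_le.
  have hi : (prefix_code u j)%:R <= 2 ^+ j * dsum id u :> R.
    by rewrite pu ler_pM2l ?exprn_gt0// dsum_ge.
  have la : 2 ^+ j * a <= 2 ^+ j * dsum id u by rewrite ler_pM2l ?exprn_gt0.
  have lb : 2 ^+ j * dsum id u <= 2 ^+ j * b by rewrite ler_pM2l ?exprn_gt0.
  have k0q : (k0 <= prefix_code u j)%N.
    rewrite /k0; have [a0|a0] := leP 0 (2 ^+ j * a).
      have : (Num.truncn (2 ^+ j * a) <= prefix_code u j + 1)%N.
        rewrite -(ler_nat R) natrD.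
        by have /andP[h _] := truncn_itv a0; lra.
      by lia.
    suff -> : Num.truncn (2 ^+ j * a) = 0%N by [].
    by apply/truncn0Pn; rewrite -ltNge; lra.
  exists (prefix_code u j - k0)%N; last first.
    by exists u => //=; rewrite subnKC.
  rewrite /= ltnS truncn_ge_nat ?addr_ge0// natrB//.
  have : 2 ^+ j * a < k0%:R + 2.
    apply: lt_le_trans (truncnS_gt _) _.
    by rewrite -natrD ler_nat /k0 addn2; case: Num.truncn.
  by rewrite mulrBr; lra.
- move=> i; apply: diam_le; first by rewrite ltW// exp2V_gt0.
  move=> _ _ [u /= ui <-] [v /= vi <-]; rewrite cdist_emb.
  apply: psum_dist_cyl => //.
  have /eqP : (prefix_code u j)%:R = (prefix_code v j)%:R :> R by rewrite ui vi.
  rewrite !prefix_codeE; have h0 : (2 : R) ^+ j != 0.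
    by rewrite expf_neq0// pnatr_eq0.
  by move=> /eqP /(mulfI h0).
Qed.

(** Along the [j] with [j <= s e_j + c] the cylinders cost at most [(2^j (b-a) + 3) 2^(-s e_j) <=
    2^c (b-a) + 3 * 2^(-s e_j)], whose last term vanishes in the limit. *)
Lemma hausdorff_measure_digit_arc_le e (s c a b : R) (E : set C) :
  (forall i, e i < e i.+1)%N -> 0 < s -> a <= b ->
  (forall N, exists2 j, (N <= j)%N & j%:R <= s * (e j)%:R + c) ->
  (hausdorff_measure s (E `|` digit_arc e a b) <=
   hausdorff_measure s E + (2 `^ c * (b - a))%:E)%E.
Proof.
move=> he s0 ab hj; apply: hausdorff_measure_le => eps e0.
apply/lee_addgt0Pr => del del0.
(* The second bound makes [3 * (2^-(e j))^s] at most [del]. *)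
have x0 : 0 < Num.min eps ((del / 3) `^ s^-1).
  by rewrite lt_min e0 powR_gt0// divr_gt0.
have [n] := exp2V_lt x0; rewrite lt_min => /andP[n1 n2].
have [j nj jc] := hj n.
have ej : 2 ^- e j <= 2 ^- n :> R.
  by rewrite ler_exp2V// (leq_trans nj)// ge_id.
have [N [D [ND Dc Dd]]] := digit_arc_cover j he ab.
have d0 : 0 <= 2 ^- e j :> R by rewrite ltW// exp2V_gt0.
apply: le_trans
  (hausdorff_content_finite_cover E (d := 2 ^- e j) (eps := eps) _ _ Dc Dd) _.
- exact: ltW.
- by rewrite d0 (le_lt_trans ej).
rewrite -addeA; apply: leeD; first exact: hausdorff_content_le.
rewrite -EFinD lee_fin.
apply: (@le_trans _ _ ((2 ^+ j * (b - a) + 3) * (2 ^- e j) `^ s)).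
  by rewrite ler_wpM2r ?powR_ge0.
rewrite mulrDl lerD//.
  rewrite mulrAC ler_wpM2r ?subr_ge0// powR_exp2V.
  rewrite -powR_mulrn// -powRD ?pnatr_eq0 ?implybT//.
  by apply: ler_powR; [rewrite ler1n|lra].
rewrite mulrC -ler_pdivlMr//.
have -> : del / 3 = ((del / 3) `^ s^-1) `^ s.
  by rewrite -powRrM mulVf ?gt_eqF// powRr1// ltW// divr_gt0.
rewrite ge0_ler_powR ?nnegrE ?powR_ge0 ?(ltW s0)//.
by rewrite (le_trans ej)// ltW.
Qed.

(** The measure of the arc up to [y] is Lipschitz in [y], zero at 0 and at least [2^c / 8] at 1, so
    the intermediate value theorem applies. *)
Lemma digit_arc_exact e (s c c' m : R) j0 :
  (forall i, e i < e i.+1)%N -> 0 < s ->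
  (forall j, (j0 <= j)%N -> s * (e j)%:R + c <= j%:R) ->
  (forall N, exists2 j, (N <= j)%N & j%:R <= s * (e j)%:R + c') ->
  0 <= m <= 2 `^ c / 8 ->
  exists y, hausdorff_measure s (digit_arc e 0 y) = m%:E.
Proof.
move=> he s0 hlo hup /andP[m0 mc].
pose H y := hausdorff_measure s (digit_arc e 0 y).
have K0 : 0 < (2 : R) `^ c' by rewrite powR_gt0.
have sub y y' : y <= y' -> digit_arc e 0 y `<=` digit_arc e 0 y'.
  move=> yy _ [u /= /andP[u0 uy] <-]; exists u => //=.
  by rewrite u0 (le_trans uy).
have Hadd y y' : y <= y' -> (H y' <= H y + (2 `^ c' * (y' - y))%:E)%E.
  move=> yy.
  rewrite (le_trans _ (hausdorff_measure_digit_arc_le _ he s0 yy hup))//.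
  apply: hausdorff_measure_subset => _ [u /= /andP[u0 uy'] <-].
  have [uy|/ltW yu] := leP (dsum id u) y; [left|right]; exists u => //=.
    by rewrite u0.
  by rewrite yu.
have H0 y : y <= 0 -> H y = 0%E.
  move=> y0; apply/eqP; rewrite eq_le hausdorff_measure_ge0 andbT.
  apply: (@le_trans _ _ (H 0)).
    exact: hausdorff_measure_subset (sub _ _ y0).
  have := hausdorff_measure_digit_arc_le set0 he s0 (lexx 0) hup.
  by rewrite set0U hausdorff_measure_set0// subrr mulr0 add0e.
have Hfin y : H y \is a fin_num.
  rewrite ge0_fin_numE ?hausdorff_measure_ge0//.
  have [/H0 ->|/ltW y0] := leP y 0; first exact: ltry.
  by apply: le_lt_trans (Hadd _ _ y0) _; rewrite H0// add0e ltry.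
pose f y := fine (H y).
have fE y : H y = (f y)%:E by rewrite fineK.
have flip y y' : y <= y' -> 0 <= f y' - f y <= 2 `^ c' * (y' - y).
  move=> yy; apply/andP; split.
    rewrite subr_ge0 -lee_fin -!fE.
    exact: hausdorff_measure_subset (sub _ _ yy).
  by rewrite lerBlDl -lee_fin EFinD -!fE; exact: Hadd.
have fcont : continuous f.
  move=> x; apply/cvgrPdist_le => eps eps0; near=> t.
  have xt : `|x - t| <= eps / 2 `^ c'.
    by near: t; apply: cvgr_dist_le; [exact: cvg_id|exact: divr_gt0].
  have {}xt : 2 `^ c' * `|x - t| <= eps by rewrite mulrC -ler_pdivlMr.
  apply: le_trans xt.
  have [h|/ltW h] := leP x t.
    have /andP[h1 h2] := flip _ _ h.
    by rewrite [leLHS]distrC [`|x - t|]distrC !ger0_norm// subr_ge0.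
  have /andP[h1 h2] := flip _ _ h.
  by rewrite !ger0_norm// subr_ge0.
have f1 : 2 `^ c / 8 <= f 1.
  by rewrite -lee_fin -fE; exact: hausdorff_measure_digit_ge he s0 hlo.
have f0 : f 0 = 0 by rewrite /f H0.
have [||y _ fy] := @IVT R f 0 1 m ler01.
- exact: continuous_subspaceT.
- by rewrite f0 ge_min le_max m0/= (le_trans mc f1) orbT.
by exists y; rewrite -/(H y) fE fy.
Unshelve. all: by end_near. Qed.

End DigitSets.

(** * Compactness and separating annuli *)

Section Topology.
Variable R : realType.
Local Notation C := (cplane R).
Implicit Types (e : nat -> nat) (u v : nat -> bool) (F : set C) (w x y z : C).

Lemma cdist_normC z w : `|z - w| = ((cdist z w)%:C)%C.
Proof. by rewrite normc_def /cdist; case: (z - w). Qed.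

Lemma emb_continuous : continuous (@emb R).
Proof.
(* Here [eps] ranges over [R[i]], where positive means real and positive. *)
move=> t; apply/cvgrPdist_lt => eps; rewrite ltcE /= => /andP[/eqP im0 eps0].
near=> s; rewrite cdist_normC cdist_emb ltcE /= im0 eqxx /=.
by near: s; apply: cvgr_dist_lt; [exact: cvg_id|].
Unshelve. all: by end_near. Qed.

Lemma cantor_nbhs_agree (u : cantor_space) n :
  nbhs u [set v : cantor_space | forall k, (k < n)%N -> u k = v k].
Proof.
elim: n => [|n IH]; first by apply: filterS filterT => v _ k.
have h : nbhs u [set v : cantor_space | u n = v n].
  have := @proj_continuous nat (fun=> bool) n u [set u n] (discrete_set1 (u n)).
  by apply: filterS => v /= ->.
apply: filterS (filterI IH h) => v [h1 h2] k; rewrite ltnS leq_eqVlt.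
by move=> /orP[/eqP ->|] //; exact: h1.
Qed.

Lemma dsum_continuous e : (forall i, e i < e i.+1)%N ->
  continuous (dsum e : cantor_space -> R).
Proof.
move=> he u; apply/cvgrPdist_lt => eps eps0.
have [n hn] := exp2V_lt eps0.
apply: filterS (cantor_nbhs_agree u n) => v /= h.
apply: le_lt_trans hn; apply: le_trans (dsum_agree he h) _.
by rewrite ler_exp2V// ge_id.
Qed.

(** The sequences with parameter in [[a, b]] form a closed subset of the compact Cantor space, and
    the arc is their continuous image. *)
Lemma digit_arc_compact e (a b : R) : (forall i, e i < e i.+1)%N ->
  compact (digit_arc e a b).
Proof.
move=> he; rewrite /digit_arc.
apply: (@continuous_compact cantor_space C (fun u => emb (dsum e u))).
  apply: continuous_subspaceT => u.
  by apply: continuous_comp; [exact: dsum_continuous|exact: emb_continuous].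
apply: (subclosed_compact _ cantor_space_compact) => //.
have /continuous_closedP := @dsum_continuous id id_ltS.
have ab : closed (`[a, b] : set R) by exact: interval_closed.
move=> /(_ _ ab).
by congr closed; apply/seteqP; split => u /=; rewrite in_itv.
Qed.

(** * Connectedness of the two sides of an annulus *)

Lemma segment_connected_component (A : set C) z y :
  (forall t : R, 0 <= t <= 1 -> A (z + emb t * (y - z))) ->
  connected_component A z y.
Proof.
move=> h; pose g (t : R) : C := z + emb t * (y - z).
exists (g @` `[0, 1]); last first.
  by exists 1 => /=; rewrite ?in_itv/= ?ler01 ?lexx// /g /emb mul1r addrC subrK.
split.
- by exists 0 => /=; rewrite ?in_itv/= ?ler01 ?lexx// /g /emb mul0r addr0.
- by move=> x [t /=]; rewrite in_itv/= => t01 <-; exact: h.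
- apply: connected_continuous_connected (@segment_connected R 0 1) _.
  apply: continuous_subspaceT => t; apply: cvgD; first exact: cvg_cst.
  by apply: cvgM; [exact: emb_continuous|exact: cvg_cst].
Qed.

Lemma normc_le_add (z w : R[i]) :
  Normc.normc (z + w) <= Normc.normc z + Normc.normc w.
Proof. exact: le_normcD. Qed.

Lemma normc_emb_mul (t : R) (z : R[i]) : 0 <= t ->
  Normc.normc (emb t * z) = t * Normc.normc z.
Proof.
move=> t0; rewrite Normc.normcM; congr (_ * _).
by rewrite /emb /= expr0n addr0 sqrtr_sqr ger0_norm.
Qed.

Lemma disc_connected (w : C) (r rho : R) z y : r < rho ->
  cdist z w <= r -> cdist y w <= r ->
  connected_component (~` annulus w r rho) z y.
Proof.
move=> rrho zr yr; apply: segment_connected_component => t /andP[t0 t1].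
rewrite /annulus /= => /andP[+ _]; apply/negP; rewrite -leNgt /cdist.
have -> : z + emb t * (y - z) - w =
    emb (1 - t) * (z - w) + emb t * (y - w).
  by rewrite /emb rmorphB rmorph1; ring.
apply: le_trans (normc_le_add _ _) _.
rewrite !normc_emb_mul ?subr_ge0//.
move: zr yr; rewrite /cdist; move: (Normc.normc _) (Normc.normc _) => p q.
by nra.
Qed.

Lemma normc_ge_coord (z : R[i]) (rho : R) : 0 <= rho ->
  rho <= `|complex.Re z| \/ rho <= `|complex.Im z| -> rho <= Normc.normc z.
Proof.
case: z => a b rho0 /= h.
rewrite -(ger0_norm rho0) -sqrtr_sqr ler_wsqrtr//.
have sq (p : R) : rho <= `|p| -> rho ^+ 2 <= p ^+ 2.
  by move=> hp; rewrite -(real_normK (num_real p)) ler_sqr ?nnegrE.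
by case: h => /sq; have := sqr_ge0 a; have := sqr_ge0 b; lra.
Qed.

(* The exterior of a disc is covered by four pairwise overlapping half planes
   and radial half lines, all convex. *)
Lemma exterior_connected (w : C) (r rho : R) z y : 0 < rho ->
  rho <= cdist z w -> rho <= cdist y w ->
  connected_component (~` annulus w r rho) z y.
Proof.
move=> rho0; pose cc := connected_component (~` annulus w r rho).
(* It suffices to join each exterior point to one corner of the square of half side [rho] about [w]:
   push the point radially into a half plane, then pass between overlapping half planes through
   corners. *)
suff corner : forall x : C, rho <= cdist x w -> cc x (w + Complex rho rho).
  move=> /corner hz /corner hy.
  exact: connected_component_trans hz (connected_component_sym hy).
have outP (x : C) : rho <= cdist x w -> (~` annulus w r rho) x.
  by move=> h; rewrite /annulus /= => /andP[_]; rewrite ltNge h.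
have seg p q : (forall t, 0 <= t <= 1 ->
    let v := p + emb t * (q - p) in
    rho <= `|complex.Re v| \/ rho <= `|complex.Im v|) -> cc (w + p) (w + q).
  move=> h; apply: segment_connected_component => t t01; apply: outP.
  rewrite /cdist; apply: normc_ge_coord (ltW rho0) _.
  suff -> : w + p + emb t * (w + q - (w + p)) - w = p + emb t * (q - p).
    exact: h.
  by ring.
have halfR (s a b c d : R) : `|s| = 1 -> rho <= s * a -> rho <= s * c ->
    cc (w + Complex a b) (w + Complex c d).
  move=> s1 ha hc; apply: seg => t /andP[t0 t1] /=; left.
  rewrite -[leRHS]mul1r -s1 -normrM (le_trans _ (ler_norm _))//.
  by nra.
have halfI (s a b c d : R) : `|s| = 1 -> rho <= s * b -> rho <= s * d ->
    cc (w + Complex a b) (w + Complex c d).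
  move=> s1 ha hc; apply: seg => t /andP[t0 t1] /=; right.
  rewrite -[leRHS]mul1r -s1 -normrM (le_trans _ (ler_norm _))//.
  by nra.
have far (p : R) : p != 0 -> exists2 T, 1 <= T & rho <= T * `|p|.
  move=> p0; exists (1 + rho / `|p|).
    by rewrite lerDl divr_ge0// ltW.
  by rewrite mulrDl mul1r divfK ?normr_eq0// lerDr.
have radial (x : C) (T a b : R) : rho <= cdist x w -> 1 <= T ->
    x - w = Complex a b -> cc x (w + Complex (T * a) (T * b)).
  move=> hx T1 xab.
  apply: segment_connected_component => t /andP[t0 t1]; apply: outP.
  apply: (le_trans hx); rewrite /cdist.
  have xw : x = w + Complex a b by rewrite -xab addrC subrK.
  have -> : x + emb t * (w + Complex (T * a) (T * b) - x) - w =
      emb (1 + t * (T - 1)) * (x - w).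
    rewrite xab xw; have -> : Complex (T * a) (T * b) = emb T * Complex a b.
      by rewrite /emb; simpc.
    by rewrite /emb rmorphD rmorphM rmorphB rmorph1; ring.
  have tT : 0 <= t * (T - 1) by rewrite mulr_ge0// subr_ge0.
  rewrite normc_emb_mul; last by lra.
  apply: ler_peMl; last by lra.
  exact: le_trans (ltW rho0) hx.
move=> x hx; case xab : (x - w) => [a b].
have [a0|a0] := eqVneq a 0; last first.
  have [T T1 hT] := far _ a0.
  apply: connected_component_trans (radial _ _ _ _ hx T1 xab) _.
  have [ap|an] := leP 0 a.
    apply: (halfR 1); rewrite ?normr1 ?mul1r//.
    by rewrite ger0_norm in hT.
  apply: (@connected_component_trans _ _ (w + Complex (- rho) rho)).
    apply: (halfR (-1)); rewrite ?normrN1//; last by lra.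
    by rewrite ltr0_norm// in hT; lra.
  by apply: (halfI 1); rewrite ?normr1// mul1r.
have b0 : b != 0.
  apply/eqP => b0; move: hx; rewrite /cdist xab a0 b0 /= expr0n addr0 sqrtr0.
  by rewrite leNgt rho0.
have [T T1 hT] := far _ b0.
apply: connected_component_trans (radial _ _ _ _ hx T1 xab) _.
have [bp|bn] := leP 0 b.
  apply: (halfI 1); rewrite ?normr1 ?mul1r//.
  by rewrite ger0_norm in hT.
apply: (@connected_component_trans _ _ (w + Complex rho (- rho))).
  apply: (halfI (-1)); rewrite ?normrN1//; last by lra.
  by rewrite ltr0_norm// in hT; lra.
by apply: (halfR 1); rewrite ?normr1// mul1r.
Qed.

(** Since the disc and the exterior are each connected, one point of [F] on either side meets the
    component of every point of the complement. *)
Lemma separates_annulus (w : C) (r rho : R) F : 0 < r -> r < rho ->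
  F `&` annulus w r rho = set0 ->
  (exists2 x, F x & cdist x w <= r) -> (exists2 y, F y & rho <= cdist y w) ->
  separates (annulus w r rho) F.
Proof.
move=> r0 rrho FA [x Fx xr] [y Fy yrho]; split => // z Az.
have rho0 : 0 < rho by apply: lt_trans rrho.
have [zr|zr] := leP (cdist z w) r.
  by exists x; split => //; exact: disc_connected.
have [zrho|zrho] := leP rho (cdist z w).
  by exists y; split => //; exact: exterior_connected.
by case: Az; rewrite /annulus /= zr zrho.
Qed.

(** * Gaps of the digit positions and empty annuli *)

Definition unbounded_gaps e :=
  forall M i0, exists2 i, (i0 <= i)%N & (e i + M <= e i.+1)%N.

(** At a gap between [e i] and [e (i+1)] the dichotomy excludes all distances between the two radii,
    which are the same for every centre. Taking [i] large makes the outer radius small. *)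
Lemma gap_annulus e (A del : R) : (forall i, e i < e i.+1)%N ->
  unbounded_gaps e -> 0 < del ->
  exists r rho, [/\ 0 < r, r < rho, rho <= del, A <= rho / r &
    forall u v, `|dsum e u - dsum e v| <= r \/ rho <= `|dsum e u - dsum e v|].
Proof.
move=> he gaps del0; have [i0 hi0] := exp2V_lt del0.
(* The gap gives [2^-(e i + 1) >= 2^(M-1) r >= M r]; subtracting [r] leaves a ratio above [|A| + 1],
   which covers both [r < rho] and [A <= rho / r]. *)
pose M := (Num.truncn `|A|).+3.
have [i i0i hi] := gaps M i0.
exists (2 ^- e i.+1), (2 ^- (e i).+1 - 2 ^- e i.+1).
have p1 := @exp2V_gt0 R (e i.+1).
have hA : `|A| + 2 < M%:R.
  by rewrite /M -(addn2 (Num.truncn `|A|).+1) natrD ltrD2r truncnS_gt.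
have hM : M%:R * 2 ^- e i.+1 <= (2 : R) ^- (e i).+1.
  apply: (@le_trans _ _ (2 ^+ M.-1 * 2 ^- e i.+1)).
    by rewrite ler_pM2r// -natrX ler_nat /M /= ltn_expl.
  rewrite -ler_pdivlMl ?exprn_gt0// -invfM -exprD ler_exp2V//.
  by move: hi; rewrite /M /=; lia.
have A0 := normr_ge0 A; have A1 := ler_norm A.
split => //.
- by nra.
- apply: (le_trans _ (ltW hi0)); have : (2 : R) ^- (e i).+1 <= 2 ^- i0.
    by rewrite ler_exp2V// (leq_trans i0i)// (leq_trans (ge_id he i)).
  by lra.
- by rewrite ler_pdivlMr//; nra.
- move=> u v; have [[_ h]|h] := @dsum_dist_dichotomy R e u v i he;
    [by left|by right].
Qed.

(** Around one of two distinct points of [F], an empty annulus of modulus at least [b + 1] with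
    outer radius at most their distance separates [F], contradicting the bound [b]. *)
Lemma digit_set_HNUP e F : (forall i, e i < e i.+1)%N -> unbounded_gaps e ->
  F `<=` digit_arc e 0 1 -> ~ uniformly_perfect F.
Proof.
move=> he gaps FE [_ [x [y [Fx Fy xy]]] [b hb]].
have [u _ ux] := FE _ Fx; have [v _ vy] := FE _ Fy.
have uv0 : 0 < `|dsum e v - dsum e u| :> R.
  rewrite normr_gt0 subr_eq0; apply/eqP => vu.
  by apply: xy; rewrite -ux -vy vu.
have [r [rho [r0 rrho rhod A dich]]] := gap_annulus (expR (b + 1)) he gaps uv0.
have q0 : 0 < rho / r by rewrite divr_gt0// (lt_trans r0).
have : separates (annulus x r rho) F.
  apply: separates_annulus => //.
  - apply/seteqP; split => // z [/FE[k _ <-]].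
    rewrite /annulus /= -ux cdist_emb => /andP[h1 h2].
    by case: (dich k u) => h; [rewrite ltNge h in h1|rewrite ltNge h in h2].
  - by exists x => //; rewrite -ux cdist_emb subrr normr0 ltW.
  - by exists y => //; rewrite -ux -vy cdist_emb.
move=> /(hb _ _ _ r0 rrho).
have : b + 1 <= ln (rho / r) by rewrite -ler_expR lnK.
by lra.
Qed.

Lemma digit_set_isolating_annulus e x (M : R) : (forall i, e i < e i.+1)%N ->
  unbounded_gaps e -> digit_arc e 0 1 x -> 1 < M ->
  exists r rho : R, [/\ 0 < r, 0 < rho, M <= rho / r,
    [set y | @real_line R y /\ r < cdist y x < rho]
      `<=` @real_line R `\` digit_arc e 0 1
    & [set y | @real_line R y /\ rho <= cdist y x] `&` digit_arc e 0 1 !=set0].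
Proof.
move=> he gaps [u _ <-] M1.
(* The all-zero and all-one sequences have different sums, so one of them differs from that of
   [u]. *)
have [v vu] : exists v, dsum e v != dsum e u :> R.
  pose u0 (_ : nat) := false; pose u1 (_ : nat) := true.
  have [u0u|] := eqVneq (dsum e u0) (dsum e u :> R); last by exists u0.
  exists u1; rewrite -u0u gt_eqF//.
  apply: lt_le_trans (dsum_ge u1 1 he).
  have -> : dsum e u0 = 0 :> R.
    apply/eqP; rewrite eq_le dsum_ge0// andbT; apply: ge_sup.
      by exists (psum e u0 0), 0%N.
    by move=> _ [n _ <-]; rewrite /psum big1// => k _; rewrite mul0r.
  by rewrite psumS /psum big_ord0 add0r mul1r exp2V_gt0.
have vu0 : 0 < `|dsum e v - dsum e u| :> R by rewrite normr_gt0 subr_eq0.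
have [r [rho [r0 rrho rhod A dich]]] := gap_annulus M he gaps vu0.
have rho0 : 0 < rho by exact: lt_trans rrho.
exists r, rho; split => //.
- move=> z /= [zR zr]; split => // -[k _ kz].
  move: zr; rewrite -kz cdist_emb => /andP[h1 h2].
  by case: (dich k u) => h; [rewrite ltNge h in h1|rewrite ltNge h in h2].
- exists (emb (dsum e v)); split; last by rewrite digit_arc01; exists v.
  by split; [exists (dsum e v)|rewrite cdist_emb].
Qed.

End Topology.

(** * Logarithmic capacity *)

Section Capacity.
Variable R : realType.
Local Notation C := (cplane R).
Implicit Types (E : set C).

Definition dist_prod n (z : 'I_n -> C) : R :=
  \prod_(j < n) \prod_(k < n | (j < k)%N) cdist (z j) (z k).

Lemma cdist_ge0 (z w : C) : 0 <= cdist z w.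
Proof. by rewrite /cdist; case: (z - w) => a b; rewrite sqrtr_ge0. Qed.

Lemma dist_prod_ge0 n (z : 'I_n -> C) : 0 <= dist_prod z.
Proof.
by apply: prodr_ge0 => j _; apply: prodr_ge0 => k _; exact: cdist_ge0.
Qed.

Lemma prod_lift (A : comNzRingType) n (i : 'I_n.+1) (P : pred 'I_n.+1)
    (G : 'I_n.+1 -> A) :
  \prod_(j < n | P (lift i j)) G (lift i j) =
  \prod_(j < n.+1 | (j != i) && P j) G j.
Proof.
rewrite big_mkcond [RHS]big_mkcond (bigD1_ord i)//= eqxx mul1r.
by apply: eq_bigr => j _; rewrite eq_sym neq_lift.
Qed.

(* Omitting each of the points in turn counts every pair [n.+1 - 2] times. *)
Lemma dist_prod_lift n (z : 'I_n.+1 -> C) :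
  \prod_(i < n.+1) dist_prod (fun j => z (lift i j)) = dist_prod z ^+ n.-1.
Proof.
have step i : dist_prod (fun j => z (lift i j)) =
    \prod_(j < n.+1) \prod_(k < n.+1 | (j < k)%N)
      if (i != j) && (i != k) then cdist (z j) (z k) else 1.
  rewrite /dist_prod.
  under eq_bigr => j _.
    (* [lift i] preserves the order, so the condition can be put on the lifted indices. *)
    rewrite (eq_bigl (fun k => (lift i j < lift i k)%N)); last first.
      by move=> k /=; rewrite /bump; case: leqP; case: leqP; lia.
    rewrite (prod_lift i (fun k => lift i j < k)%N
      (fun k => cdist (z (lift i j)) (z k))).
    over.
  rewrite (prod_lift i xpredT (fun j => \prod_(k < n.+1 | (k != i) && (j < k)%N)
    cdist (z j) (z k))) big_mkcond.
  apply: eq_bigr => j _; rewrite andbT [i == j]eq_sym.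
  case: (j != i) => /=; last by rewrite big1.
  rewrite big_mkcond [RHS]big_mkcond; apply: eq_bigr => k _.
  by rewrite [i == k]eq_sym; case: (k != i); case: (j < k)%N.
rewrite (eq_bigr _ (fun i _ => step i)) exchange_big /dist_prod -prodrXl.
apply: eq_bigr => j _; rewrite exchange_big -prodrXl; apply: eq_bigr => k jk.
rewrite -big_mkcond prodr_const; congr (_ ^+ _).
have jkn : j != k by rewrite neq_ltn jk.
have := cardC (pred2 j k); rewrite card2 jkn card_ord.
rewrite [X in _ -> X = _](eq_card (B := [predC pred2 j k])).
  by move: #|_| => c /= h; move: h; rewrite add2n => -[<-].
by move=> i; rewrite !inE negb_or.
Qed.

Section BoundedSet.
Variable E : set C.
Hypothesis E0 : E !=set0.
Hypothesis E1 : forall x y, E x -> E y -> cdist x y <= 1.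

Lemma dist_prod_le_max n (z : 'I_n -> C) : (forall j, E (z j)) ->
  dist_prod z <= max_dist_prod E n.
Proof.
move=> Ez; apply: ub_le_sup; last by exists z.
exists 1 => _ [y Ey <-]; apply: prodr_ile1 => j _.
rewrite prodr_ge0/= => [|k _]; last exact: cdist_ge0.
by apply: prodr_ile1 => k _; rewrite cdist_ge0 E1.
Qed.

Lemma max_dist_prod_le n x :
  (forall z : 'I_n -> C, (forall j, E (z j)) -> dist_prod z <= x) ->
  max_dist_prod E n <= x.
Proof.
move=> h; apply: ge_sup; last by move=> _ [z Ez <-]; exact: h.
by have [p Ep] := E0; exists (@dist_prod n (fun=> p)), (fun=> p).
Qed.

Lemma max_dist_prod_ge0 n : 0 <= max_dist_prod E n.
Proof.
have [p Ep] := E0; rewrite (le_trans (dist_prod_ge0 (fun _ : 'I_n => p)))//.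
exact: dist_prod_le_max.
Qed.

(** Omitting each point in turn bounds [dist_prod z ^ (n-1)] by a product of [n+1] factors at most
    [P], so the maximum for [n+1] points is at most [P^((n+1)/(n-1))]; the normalising exponents
    then match. *)
Lemma nth_diam_nonincreasing n : (1 < n)%N -> nth_diam E n.+1 <= nth_diam E n.
Proof.
move=> n1; set P := max_dist_prod E n.
have P0 : 0 <= P by exact: max_dist_prod_ge0.
have n10 : 0 < n.-1%:R :> R by rewrite ltr0n; lia.
have n0 : 0 < n%:R :> R by rewrite ltr0n; lia.
have key : max_dist_prod E n.+1 <= P `^ (n.+1%:R / n.-1%:R).
  apply: max_dist_prod_le => z Ez.
  have : dist_prod z ^+ n.-1 <= P ^+ n.+1.
    rewrite -dist_prod_lift.
    have -> : P ^+ n.+1 = \prod_(i < n.+1) P by rewrite prodr_const card_ord.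
    apply: ler_prod => i _; rewrite dist_prod_ge0/=.
    exact: dist_prod_le_max.
  rewrite -!powR_mulrn ?dist_prod_ge0// powRrM => h.
  have := ge0_ler_powR (r := n.-1%:R^-1) _ _ _ h.
  rewrite !nnegrE invr_ge0 ?powR_ge0 ?(ltW n10) => /(_ isT isT isT).
  by rewrite -powRrM divff ?gt_eqF// powRr1 ?dist_prod_ge0.
rewrite /nth_diam -/P.
apply: (@le_trans _ _
  ((P `^ (n.+1%:R / n.-1%:R)) `^ (2 / (n.+1 * n.+1.-1)%:R))).
  by rewrite ge0_ler_powR ?nnegrE ?powR_ge0 ?max_dist_prod_ge0// divr_ge0.
rewrite -powRrM le_eqVlt; apply/orP; left; apply/eqP; congr (_ `^ _).
rewrite !natrM /=; field.
by rewrite !gt_eqF// ?ltr0n.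
Qed.

Lemma capacity_gt0 (b : R) : 0 < b ->
  (forall n, (1 < n)%N -> b <= nth_diam E n) -> 0 < capacity E.
Proof.
move=> b0 hb; apply: (lt_le_trans b0).
pose D n := nth_diam E (n + 2)%N.
have Dcvg : cvgn D.
  apply: nonincreasing_is_cvgn.
    apply/nonincreasing_seqP => n; rewrite /D addSn.
    by apply: nth_diam_nonincreasing; rewrite addn2.
  by exists b => _ [n _ <-]; apply: hb; lia.
have : cvgn (nth_diam E).
  move/cvg_ex: Dcvg => [l Dl]; apply/cvg_ex; exists l.
  by rewrite -(cvg_shiftn 2).
move=> h; apply: limr_ge => //; exists 2%N => // n /= n2; exact: hb.
Qed.

End BoundedSet.

(** * Lower bound for products over an equidistant grid *)

Lemma bin_le_exp2 n m : ('C(n, m) <= 2 ^ n)%N.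
Proof.
elim: n m => [[|m]//|n IH [|m]]; first by rewrite bin0 expn_gt0.
by rewrite binS expnS mul2n -addnn leq_add.
Qed.

(** A crude Stirling bound: [n^m] is at most the falling factorial of [n + m], which is a binomial
    coefficient, at most [2^(2n)], times [m!]. *)
Lemma exp_le_fact n m : (m <= n)%N -> (n ^ m <= 4 ^ n * m`!)%N.
Proof.
move=> mn; apply: (@leq_trans ((n + m) ^_ m)).
  rewrite ffact_prod -[m in (_ ^ m)%N]card_ord -prod_nat_const.
  by apply: leq_prod => i _; have := ltn_ord i; lia.
rewrite -bin_ffact leq_mul2r (leq_trans (bin_le_exp2 _ _)) ?orbT//.
by rewrite -[4%N]/(2 ^ 2)%N -expnM leq_exp2l//; lia.
Qed.

(** With [m = n - j - 1] the product equals [m! / n^m]. *)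
Lemma prod_grid_ge n (j : 'I_n) :
  (4 : R) ^- n <= \prod_(k < n | (j < k)%N) ((k%:R - j%:R) / n%:R).
Proof.
have n0 : (0 < n)%N by case: n j => // -[].
have nR : 0 < n%:R :> R by rewrite ltr0n.
have -> : \prod_(k < n | (j < k)%N) ((k%:R - j%:R) / n%:R) =
    (n - j.+1)`!%:R / n%:R ^+ (n - j.+1) :> R.
  rewrite -(big_mkord (fun k => (j < k)%N) (fun k => (k%:R - j%:R) / n%:R)).
  rewrite (big_cat_nat _ (n := j.+1)) //=.
  rewrite big_nat_cond big_pred0 ?mul1r; last by move=> k; lia.
  rewrite -{1}[j.+1]add0n big_addn.
  rewrite (eq_big xpredT (fun i => i.+1%:R / n%:R)) => [|i|i _]; last 2 first.
  - by rewrite addnS ltnS leq_addl.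
  - by rewrite addnS -addSn natrD addrK.
  elim: (n - j.+1)%N => [|m IH]; first by rewrite big_nil divr1.
  rewrite big_nat_recr//= IH factS natrM exprS invfM mulrACA; congr (_ * _).
    exact: mulrC.
  exact: mulrC.
have mn : (n - j.+1 <= n)%N by exact: leq_subr.
rewrite ler_pdivlMr ?exprn_gt0// ler_pdivrMl ?exprn_gt0//.
by rewrite -!natrX -natrM ler_nat exp_le_fact.
Qed.

(** Squaring the Hoelder estimate with exponent 1/2 gives the factor 16 for close points; distances
    [d >= 2^-(e j0)] are absorbed by [1 <= 2^(e j0) d]. *)
Lemma dsum_sqr_holder e j0 : (forall i, e i < e i.+1)%N ->
  (forall j, (j0 <= j)%N -> 2^-1 * (e j)%:R <= j%:R :> R) ->
  exists2 A : R, 1 <= A & forall u v,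
    `|dsum id u - dsum id v| ^+ 2 <= A * `|dsum e u - dsum e v|.
Proof.
move=> he hj; have e1 : 1 <= 2 ^+ e j0 :> R by rewrite exprn_ege1// ler1n.
exists (16 * 2 ^+ e j0); first by lra.
move=> u v; set d : R := `|dsum e u - dsum e v|.
have d0 : 0 <= d by exact: normr_ge0.
have [dj|jd] := ltP d (2 ^- e j0).
  apply: (@le_trans _ _ (16 * d)); last by rewrite ler_wpM2r//; lra.
  have := @dsum_holder R e 2^-1 0 j0 u v he _ _ dj.
  rewrite invr_gt0 ltr0n oppr0 powRr0 mulr1 powR12_sqrt// => /(_ isT) h.
  have {}h := h _; have {}h : `|dsum id u - dsum id v| <= 4 * Num.sqrt d.
    by apply: h => j jj; rewrite addr0; exact: hj.
  have -> : 16 * d = (4 * Num.sqrt d) ^+ 2.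
    by rewrite exprMn sqr_sqrtr//; ring.
  by rewrite ler_sqr ?nnegrE// mulr_ge0// sqrtr_ge0.
apply: (@le_trans _ _ 1).
  rewrite exprn_ile1// ler_norml.
  have := @dsum_ge0 R id u id_ltS; have := @dsum_le1 R id u id_ltS.
  have := @dsum_ge0 R id v id_ltS; have := @dsum_le1 R id v id_ltS.
  by move=> *; apply/andP; split; lra.
have : 2 ^+ e j0 * 2 ^- e j0 = 1 :> R.
  by rewrite divff// expf_neq0// pnatr_eq0.
have : 2 ^+ e j0 * 2 ^- e j0 <= 2 ^+ e j0 * d by rewrite ler_pM2l// exprn_gt0.
by lra.
Qed.

(** Each row of the distance product is at least [b^n], the whole at least [b^(n^2)], and the
    normalising root leaves [b^(2n/(n-1)) >= b^4]. *)
Lemma digit_set_capacity_gt0 e j0 : (forall i, e i < e i.+1)%N ->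
  (forall j, (j0 <= j)%N -> 2^-1 * (e j)%:R <= j%:R :> R) ->
  0 < capacity (@digit_arc R e 0 1).
Proof.
move=> he hj; have [A A1 hA] := dsum_sqr_holder he hj.
have A0 : 0 < A by exact: lt_le_trans A1.
have E0 : @digit_arc R e 0 1 !=set0.
  by rewrite digit_arc01; exists (emb (dsum e (fun=> false))), (fun=> false).
have E1 x y : @digit_arc R e 0 1 x -> @digit_arc R e 0 1 y -> cdist x y <= 1.
  move=> [u _ <-] [v _ <-]; rewrite cdist_emb ler_norml.
  have := @dsum_ge0 R e u he; have := @dsum_le1 R e u he.
  have := @dsum_ge0 R e v he; have := @dsum_le1 R e v he.
  by move=> *; apply/andP; split; lra.
pose b := (16 * A)^-1.
have b0 : 0 < b by rewrite invr_gt0 mulr_gt0.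
have b1 : b <= 1 by rewrite invf_le1 ?mulr_gt0//; lra.
apply: (@capacity_gt0 _ E0 E1 (b ^+ 4)); first exact: exprn_gt0.
move=> n n1; have n0 : 0 < n%:R :> R by rewrite ltr0n; lia.
have /choice[u hu] : forall i : 'I_n, exists u, dsum id u = i%:R / n%:R :> R.
  move=> i; apply: dsum_id_onto; rewrite divr_ge0//= ltr_pdivrMr// mul1r.
  by rewrite ltr_nat.
pose z i := emb (dsum e (u i) : R).
have zE i : digit_arc e 0 1 (z i) by rewrite digit_arc01; exists (u i).
(* The squared grid differences contribute [4^-n] twice, whence the 16 in [b]; since [A^-1 <= 1],
   the powers of it may be padded to [n] factors. *)
have row (j : 'I_n) : b ^+ n <= \prod_(k < n | (j < k)%N) cdist (z j) (z k).
  apply: (@le_trans _ _ (\prod_(k < n | (j < k)%N)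
     (((k%:R - j%:R) / n%:R) * ((k%:R - j%:R) / n%:R) * A^-1))); last first.
    apply: ler_prod => k jk.
    rewrite !mulr_ge0 ?invr_ge0 ?subr_ge0 ?ler_nat ?(ltnW jk) ?(ltW A0)//=.
    rewrite ler_pdivrMr// cdist_emb [leRHS]mulrC.
    apply: (le_trans _ (hA (u j) (u k))); rewrite !hu -mulrBl.
    rewrite real_normK ?num_real// le_eqVlt; apply/orP; left; apply/eqP.
    by ring.
  rewrite big_split big_split /= /b invfM exprMn.
  have -> : (16 : R)^-1 ^+ n = 4 ^- n * 4 ^- n.
    by rewrite -!exprVn -exprMn -invfM -natrM.
  have Ai : 0 <= A^-1 by rewrite invr_ge0 ltW.
  apply: ler_pM; rewrite ?mulr_ge0 ?invr_ge0 ?exprn_ge0//.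
    by apply: ler_pM; rewrite ?invr_ge0 ?exprn_ge0//; exact: prod_grid_ge.
  have -> : A^-1 ^+ n = \prod_(k < n) A^-1 by rewrite prodr_const card_ord.
  rewrite [leRHS]big_mkcond; apply: ler_prod => k _; rewrite Ai/=.
  by case: ifP => // _; rewrite invf_le1.
have tot : b ^+ (n * n) <= max_dist_prod (@digit_arc R e 0 1) n.
  apply: le_trans (@dist_prod_le_max _ E1 n z zE).
  have -> : b ^+ (n * n) = \prod_(j < n) b ^+ n.
    by rewrite prodr_const card_ord exprM.
  by apply: ler_prod => j _; rewrite exprn_ge0 ?(ltW b0)//=; exact: row.
have n10 : 0 < n.-1%:R :> R by rewrite ltr0n; lia.
apply: (@le_trans _ _ ((b ^+ (n * n)) `^ (2 / (n * n.-1)%:R))); last first.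
  rewrite ge0_ler_powR ?nnegrE ?divr_ge0 ?exprn_ge0 ?(ltW b0)//.
  exact: max_dist_prod_ge0.
rewrite -[b ^+ (n * n)]powR_mulrn ?(ltW b0)// -[b ^+ 4]powR_mulrn ?(ltW b0)//.
rewrite -powRrM /powR gt_eqF// ler_expR ler_wnM2r ?ln_le0// !natrM.
have -> : n%:R * n%:R * (2 / (n%:R * n.-1%:R)) = 2 * n%:R / n.-1%:R :> R.
  by field; rewrite !gt_eqF.
rewrite ler_pdivrMr//; have : (n <= 2 * n.-1)%N by lia.
by rewrite -(ler_nat R) natrM; lra.
Qed.

End Capacity.

(** * The choice of digit positions *)

Section Construction.
Variable R : realType.
Implicit Types (e f : nat -> nat) (u v : nat -> bool).

(** The condition that [e i] is at most [i + o(i)], in the form in which the Hoelder estimates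
    consume it. *)
Definition dense_digits e :=
  forall s c : R, 0 < s -> s < 1 ->
  exists i0, forall i, (i0 <= i)%N -> s * (e i)%:R + c <= i%:R.

Lemma tight_subsequence e (s c : R) i0 : (forall i, e i < e i.+1)%N -> 0 < s ->
  (forall i, (i0 <= i)%N -> s * (e i)%:R + c <= i%:R) ->
  exists f, [/\ forall j, (f j < f j.+1)%N,
    forall j, (i0 <= j)%N -> s * (e (f j))%:R + c <= j%:R &
    forall N, exists2 j, (N <= j)%N & j%:R <= s * (e (f j))%:R + (c + 1)].
Proof.
move=> he s0 hi.
(* [f j] is the largest [i] all of whose successors satisfy the bound when
   [e i, e (i + 1), ...] take the places [j, j + 1, ...]; maximality makes the
   bound fail for [i + 1], which gives tightness further on. *)
pose G j i := (i <= j)%N ||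
  `[< forall m, s * (e (i + m)%N)%:R + c <= (j + m)%:R >].
have Gj j : exists i, G j i by exists j; rewrite /G leqnn.
have Gub j i : G j i -> (i <= maxn j (Num.truncn ((j%:R + `|c|) / s)))%N.
  move=> /orP[ij|/asboolP/(_ 0%N)]; rewrite leq_max ?ij//.
  rewrite !addn0 => h; apply/orP; right.
  rewrite truncn_ge_nat ?divr_ge0 ?addr_ge0 ?(ltW s0)// ler_pdivlMr// mulrC.
  have : s * i%:R <= s * (e i)%:R by rewrite ler_pM2l// ler_nat ge_id.
  by have := ler_norm (- c); rewrite normrN; lra.
pose f j := ex_maxn (Gj j) (Gub j).
have fG j : G j (f j) by rewrite /f; case: ex_maxnP.
have fmax j i : G j i -> (i <= f j)%N.
  by rewrite /f; case: ex_maxnP => m _ h /h.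
have fS j : (f j < f j.+1)%N.
  apply: fmax; have /orP[h|/asboolP h] := fG j; apply/orP; [by left|right].
  by apply/asboolP => m; have := h m.+1; rewrite !addSnnS.
exists f; split => //.
- move=> j ij; have /orP[h|/asboolP/(_ 0%N)] := fG j; last by rewrite !addn0.
  have -> : f j = j; last exact: hi.
  by apply/eqP; rewrite eqn_leq h fmax// /G leqnn.
(* Failure at some offset [m] reads [N + m < s e (f N + 1 + m) + c]. The index [j = N + m + 1] has
   [f j >= f N + 1 + m], and its extra 1 is the 1 in [c + 1]. *)
- move=> N; have : ~~ G N (f N).+1.
    by apply/negP => /fmax; rewrite ltnn.
  rewrite negb_or => /andP[_ /asboolPn/existsNP[m /negP]].
  rewrite -ltNge => h; exists (N + m).+1; first by lia.
  have fm : ((f N).+1 + m <= f (N + m).+1)%N.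
    elim: m {h} => [|m IH]; first by rewrite !addn0; exact: fS.
    by rewrite !addnS (leq_ltn_trans IH).
  have : s * (e ((f N).+1 + m)%N)%:R <= s * (e (f (N + m).+1))%:R.
    by rewrite ler_pM2l// ler_nat; exact: ltS_homo_le.
  by rewrite -natr1; lra.
Qed.

Lemma psum_zeros e v m n : (m <= n)%N ->
  (forall k, (m <= k < n)%N -> v k = false) -> psum e v n = psum e v m :> R.
Proof.
elim: n => [|n IH]; first by rewrite leqn0 => /eqP ->.
rewrite leq_eqVlt => /orP[/eqP ->//|]; rewrite ltnS => mn h.
rewrite psumS h ?mn ?ltnSn// mul0r addr0 IH// => k /andP[mk kn].
by apply: h; rewrite mk ltnW.
Qed.

(** Place the bit [u j] at index [f j] and zeros elsewhere. *)
Lemma dsum_subsequence e f u : (forall i, e i < e i.+1)%N ->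
  (forall i, f i < f i.+1)%N ->
  exists v, dsum e v = dsum (e \o f) u :> R.
Proof.
move=> he hf.
have hef i : ((e \o f) i < (e \o f) i.+1)%N by exact: ltS_homo he _ _ (hf i).
pose v k := `[< exists2 j, k = f j & u j >].
have fN i j : (f i < f j)%N -> (i < j)%N.
  by apply: contraTT; rewrite -!leqNgt; exact: ltS_homo_le.
have vf j : v (f j) = u j.
  apply/asboolP/idP => [[i fij ui]|uj]; last by exists j.
  have -> // : j = i; apply/eqP; rewrite eqn_leq; apply/andP.
  by split; rewrite leqNgt; apply/negP => /(ltS_homo hf); rewrite fij ltnn.
have pE n : psum e v (f n) = psum (e \o f) u n :> R.
  elim: n => [|n IH].
    rewrite (@psum_zeros e v 0 (f 0%N))//; first by rewrite /psum !big_ord0.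
    move=> k /andP[_ k0].
    by apply/asboolP => -[j kj _]; move: k0; rewrite kj => /fN.
  rewrite (@psum_zeros e v (f n).+1)//.
    by rewrite !psumS IH vf.
  move=> k /andP[k1 k2]; apply/asboolP => -[j kj _].
  by move: k1 k2; rewrite kj => /fN + /fN; lia.
exists v; apply/eqP; rewrite -subr_eq0 -normr_le0; apply/ler_addgt0Pr => x x0.
rewrite add0r; have [n hn] := exp2V_lt x0.
have := dsum_ge v (f n) he : _ <= _ :> R.
have := dsum_le v (f n) he : _ <= _ :> R.
have := dsum_ge u n hef : _ <= _ :> R; have := dsum_le u n hef : _ <= _ :> R.
have : (2 : R) ^- e (f n) <= 2 ^- n.
  by rewrite ler_exp2V// (leq_trans (ge_id hf n))// ge_id.
rewrite pE /= => *; rewrite ler_norml; apply/andP; split; lra.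
Qed.

Lemma digit_arc_subsequence e f (a b : R) : (forall i, e i < e i.+1)%N ->
  (forall i, f i < f i.+1)%N ->
  digit_arc (e \o f) a b `<=` digit_arc e 0 1.
Proof.
move=> he hf _ [u _ <-]; rewrite digit_arc01.
by have [v vu] := dsum_subsequence u he hf; exists v => //=; rewrite vu.
Qed.

(** After a gap of length [n + 1] one has [i + 1 <= e (i+1) - n], so the upper bound with exponent 1
    and constant [-n] gives at most [2^-n]. *)
Lemma digit_set_null e : (forall i, e i < e i.+1)%N -> unbounded_gaps e ->
  hausdorff_measure 1 (@digit_arc R e 0 1) = 0%E.
Proof.
move=> he gaps; apply/eqP; rewrite eq_le hausdorff_measure_ge0 andbT.
apply/lee_addgt0Pr => x x0; rewrite add0e; have [n hn] := exp2V_lt x0.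
have tight N : exists2 j, (N <= j)%N & j%:R <= 1 * (e j)%:R + - n%:R :> R.
  have [i Ni hi] := gaps n.+1 N; exists i.+1; first exact: leqW.
  have := ge_id he i; rewrite mul1r -natrB ?ler_nat => [|]; by lia.
have := hausdorff_measure_digit_arc_le set0 he ltr01 ler01 tight.
rewrite set0U hausdorff_measure_set0// add0e subr0 mulr1 => /le_trans; apply.
by rewrite lee_fin powR_invn// ltW.
Qed.

Lemma digit_subset_measure e (s c : R) : (forall i, e i < e i.+1)%N ->
  dense_digits e -> 0 < s -> s < 1 -> 0 < c ->
  exists K, [/\ K `<=` @digit_arc R e 0 1, compact K &
    hausdorff_measure s K = c%:E].
Proof.
(* An integer [C > 8 c] satisfies [2^C / 8 >= c], so [c] is in the range reached by truncation. *)
move=> he dens s0 s1 c0; pose C : R := (Num.truncn (8 * c)).+1%:R.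
have [i0 hi0] := dens s C s0 s1.
have [f [hf lo up]] := tight_subsequence he s0 hi0.
have hef i : ((e \o f) i < (e \o f) i.+1)%N by exact: ltS_homo he _ _ (hf i).
have [|y Hy] := digit_arc_exact (m := c) hef s0 lo up.
  rewrite (ltW c0)/= ler_pdivlMr// mulrC powR_mulrn//.
  rewrite (le_trans (ltW (truncnS_gt _)))// -natrX ler_nat ltnW//.
  exact: ltn_expl.
exists (digit_arc (e \o f) 0 y); split => //.
- exact: digit_arc_subsequence.
- exact: digit_arc_compact.
Qed.

(** * Digit positions with squared logarithmic excess *)

Definition digit_pos i := (i + trunc_log 2 i ^ 2)%N.

Lemma digit_pos_lt i : (digit_pos i < digit_pos i.+1)%N.
Proof.
by rewrite /digit_pos addSn ltnS leq_add2l leq_exp2r// leq_trunc_log.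
Qed.

(** On reaching [2^(k+1)] the truncated logarithm rises from [k] to [k + 1], so the positions jump
    by at least [2 k + 2]. *)
Lemma digit_pos_gaps : unbounded_gaps digit_pos.
Proof.
move=> M i0; pose k := (i0 + M)%N.
have p0 : (0 < 2 ^ k.+1)%N by rewrite expn_gt0.
have kp : (k.+1 < 2 ^ k.+1)%N by rewrite ltn_expl.
exists (2 ^ k.+1).-1; first by rewrite /k in kp *; lia.
rewrite /digit_pos prednK// trunc_expnK//.
have : (trunc_log 2 (2 ^ k.+1).-1 <= k)%N.
  rewrite -ltnS -(ltn_exp2l _ _ (ltnSn 1)).
  apply: leq_ltn_trans (trunc_logP _ _) _ => //; last by rewrite ltn_predL.
  by lia.
move: (trunc_log _ _) => t tk.
have : (t ^ 2 <= k ^ 2)%N by rewrite leq_exp2r.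
have : (k.+1 ^ 2 = k ^ 2 + 2 * k + 1)%N by rewrite -addn1 sqrnD; lia.
by rewrite /k; lia.
Qed.

(** With [k] the truncated logarithm of [i] this gives [k^3 <= 4 i], hence [k^2 = o(i)]. From 4 on,
    [(k+1)^3 <= 2 k^3]. *)
Lemma cube_le_exp2 k : (k ^ 3 <= 4 * 2 ^ k)%N.
Proof.
elim: k => // k IH; have [k4|k4] := leqP 4 k.
  rewrite [(2 ^ k.+1)%N]expnS.
  suff : (k.+1 ^ 3 <= 2 * k ^ 3)%N by lia.
  by rewrite !expnS !expn0; nia.
by move: k4 {IH}; do 4 (case: k => [//|k]).
Qed.

Lemma digit_pos_dense : dense_digits digit_pos.
Proof.
move=> s c s0 s1; pose a := 1 - s; have a0 : 0 < a by rewrite /a; lra.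
pose K := 8 / a; have K0 : 0 < K by rewrite divr_gt0.
(* For [i >= i0] the constants [|c| + K^2] take at most half of the slack [a i]; the rest of [k^2]
   takes the other half. *)
pose i0 := (Num.truncn (2 * (`|c| + K ^+ 2) / a)).+1.
exists i0 => i ii; have i_gt0 : (0 < i)%N by rewrite (leq_trans _ ii).
have hi : `|c| + K ^+ 2 <= a * i%:R / 2.
  have : 2 * (`|c| + K ^+ 2) / a <= i%:R.
    by rewrite (le_trans (ltW (truncnS_gt _)))// ler_nat.
  by rewrite ler_pdivrMr//; lra.
rewrite /digit_pos natrD natrX; set k : R := (trunc_log 2 i)%:R.
have k0 : 0 <= k by exact: ler0n.
have k3 : k ^+ 3 <= 4 * i%:R.
  rewrite /k -natrX -natrM ler_nat (leq_trans (cube_le_exp2 _))//.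
  by rewrite leq_pmul2l// trunc_logP.
(* Large [k] is absorbed by the cubic bound, [8 k^2 <= a k^3 <= 4 a i]; small [k] by the constant
   [K^2]. *)
have k2 : k ^+ 2 <= a * i%:R / 2 + K ^+ 2.
  have i0R : 0 <= a * i%:R by rewrite mulr_ge0// ltW.
  have [Kk|kK] := leP K k.
    have : 8 * k ^+ 2 <= a * k ^+ 3.
      have -> : a * k ^+ 3 = a * k * k ^+ 2 by ring.
      apply: ler_wpM2r; first exact: sqr_ge0.
      by move: Kk; rewrite /K ler_pdivrMr// mulrC.
    have : a * k ^+ 3 <= a * (4 * i%:R) by rewrite ler_pM2l.
    by have := sqr_ge0 K; lra.
  have : k ^+ 2 <= K ^+ 2 by rewrite ler_sqr ?nnegrE ?(ltW K0)// ltW.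
  by lra.
have := ler_norm c; have : s * k ^+ 2 <= k ^+ 2.
  by rewrite ler_piMl ?sqr_ge0// ltW.
by rewrite /a in hi k2 *; lra.
Qed.

End Construction.

(** * Assembly of the properties of [W] *)

Theorem theorem1p2 (R : realType) :
  exists W : set (cplane R),
    [/\ W `<=` @real_line R,
        HNUP W,
        [/\ hausdorff_dim W = 1%E,
            hausdorff_measure 1 W = 0%E
          & 0 < capacity W],
        forall s c : R, 0 < s -> s < 1 -> 0 < c ->
          exists K : set (cplane R),
            [/\ K `<=` W,
                HNUP K,
                hausdorff_dim K = s%:E
              & hausdorff_measure s K = c%:E]
      & forall x : cplane R, W x -> forall M : R, 1 < M ->
          exists r rho : R,
            [/\ 0 < r, 0 < rho, M <= rho / r,
                [set y | @real_line R y /\ r < cdist y x < rho]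
                  `<=` @real_line R `\` W
              & [set y | @real_line R y /\ rho <= cdist y x] `&` W !=set0]].
Proof.
have he := digit_pos_lt; have gaps := digit_pos_gaps.
have dens := @digit_pos_dense R.
have W1 := digit_set_null R he gaps.
exists (digit_arc digit_pos 0 1); split.
- by move=> _ [u _ <-]; exists (dsum digit_pos u).
- split; first exact: digit_arc_compact.
  by move=> F; exact: digit_set_HNUP.
- split => //.
    apply/eqP; rewrite eq_le; apply/andP; split.
      by apply: ereal_inf_lbound; exists 1.
    (* A null exponent [t < 1] would contradict the subset of [W] whose [t]-dimensional measure is
       1. *)
    apply: le_ereal_inf_tmp => _ [t [t0 Wt] <-]; rewrite lee_fin leNgt.
    apply/negP => t1.
    have [K [KW _ Kt]] := digit_subset_measure he dens t0 t1 ltr01.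
    have := hausdorff_measure_subset t KW; rewrite Wt Kt lee_fin.
    by rewrite ler10.
  (* The square estimate behind the capacity bound corresponds to exponent 1/2. *)
  have [||j0 hj0] := dens 2^-1 0; [lra|lra|].
  apply: (digit_set_capacity_gt0 (j0 := j0) he) => j jj.
  by have := hj0 j jj; rewrite addr0.
- move=> s c s0 s1 c0.
  have [K [KW Kc Ks]] := digit_subset_measure he dens s0 s1 c0.
  exists K; split => //; last exact: hausdorff_dim_eq s0 c0 Ks.
  by split => // F FK; apply: (digit_set_HNUP he gaps); exact: subset_trans KW.
- by move=> x Wx M M1; exact: digit_set_isolating_annulus.
Qed.
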